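(* Let $0<\alpha<1$, $s>0$ and $p>0$ satisfy $s+p\alpha>1$, and let $\mu$ be a nonnegative Borel measure on $D$. Then the following conditions are equivalent: (i) The identity operator $I:F(p,p\alpha-2,s)\to T^{\infty}_{p,s}(\mu)$ is bounded. (ii) The identity operator $I:F(p,p\alpha-2,s)\to T^{\infty}_{p,s}(\mu)$ is compact. (iii) $\mu$ is an $s$-Carleson measure.
   Context: $D$ is the open unit disk of the complex plane, $H(D)$ the space of analytic functions on $D$, $dA$ the normalized area measure on $D$, and $\varphi_a(z)=(a-z)/(1-\bar a z)$ for $a\in D$. For $0<p<\infty$, $-2<q<\infty$, $0\le s<\infty$, $F(p,q,s)$ is the space of $f\in H(D)$ with $$\|f\|_{F(p,q,s)}^p=\sup_{a\in D}\int_D|f'(z)|^p(1-|z|^2)^q(1-|\varphi_a(z)|^2)^s\,dA(z)<\infty,$$ with norm (quasi-norm if $p<1$) $|||f|||_{F(p,q,s)}=|f(0)|+\|f\|_{F(p,q,s)}$. For an arc $I\subset\partial D$, $|I|$ is its normalized arc length ($|\partial D|=1$), and the Carleson box is $S(I)=\{z: 1-|I|<|z|<1,\ z/|z|\in I\}$. $T^{\infty}_{p,s}(\mu)$ is the space of all $\mu$-measurable functions $f$ on $D$ with $$\|f\|_{T^{\infty}_{p,s}(\mu)}^p=\sup_{I\subset\partial D}|I|^{-s}\int_{S(I)}|f(z)|^p\,d\mu(z)<\infty.$$ The identity operator $f\mapsto f$ is bounded if there is $C>0$ with $\|f\|_{T^\infty_{p,s}(\mu)}\le C|||f|||_{F(p,p\alpha-2,s)}$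 for all $f$; it is compact if it maps $F(p,p\alpha-2,s)$ into $T^\infty_{p,s}(\mu)$ and every bounded sequence to a sequence having a convergent subsequence in $T^\infty_{p,s}(\mu)$. $\mu$ is an $s$-Carleson measure if $\sup_{I\subset\partial D}\mu(S(I))/|I|^s<\infty$. *)

(* Defs.v *)
From HB Require Import structures.
From mathcomp Require Import all_boot all_order all_algebra.
From mathcomp Require Import complex.
From mathcomp Require Import all_classical all_reals all_analysis.
Set Implicit Arguments.
Unset Strict Implicit.
Unset Printing Implicit Defensive.
Import Order.TTheory GRing.Theory Num.Theory.
Import numFieldNormedType.Exports.
Local Open Scope classical_set_scope.
Local Open Scope ring_scope.

(* The complex plane as a normed space over itself: with this type,
   [derivable f z 1] and [derive1 f z] are complex differentiability and the complex
   derivative. *)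
Notation Cplx R := (R[i]^o).

(* The complex plane with its Borel sigma-algebra. *)
Notation BorelC R := (g_sigma_algebraType (@open (R[i]^o))).

(* The real-valued modulus; the generic norm on R[i] takes its values in R[i]. *)
Notation cabs := ComplexField.Normc.normc.

Section Disk.
Variable R : realType.
Local Notation C := (Cplx R).

Definition disk : set C := [set z | cabs z < 1].

Definition analytic (f : C -> C) : Prop :=
  forall z : C, disk z -> derivable f z 1.

Definition moebius (a z : C) : C := (a - z) / (1 - conjc a * z).

(* Normalized so that [disk] has measure 1; only used to integrate over [disk]. *)
Definition area (A : set (BorelC R)) : \bar R :=
  ((pi^-1)%:E *
    (@lebesgue_measure R \x @lebesgue_measure R)
      [set w : R * R | A (Complex w.1 w.2)])%E.

End Disk.

Section FSpace.
Variable R : realType.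
Local Notation C := (Cplx R).
Implicit Types (p q s : R) (f : C -> C).

(* The p-th power of the seminorm of F(p,q,s). *)
Definition F_seminorm_pow p q s f : \bar R :=
  ereal_sup [set (\int[@area R]_(z in @disk R)
      ((cabs (derive1 f z)) `^ p * (1 - cabs z ^+ 2) `^ q
         * (1 - cabs (moebius a z) ^+ 2) `^ s)%:E)%E | a in @disk R].

Definition F_norm p q s f : \bar R :=
  ((cabs (f 0))%:E + poweR (F_seminorm_pow p q s f) p^-1)%E.

(* Functions are total on C; only their values on [disk] matter. *)
Definition F_space p q s : set (C -> C) :=
  [set f | analytic f /\ (F_seminorm_pow p q s f < +oo)%E].

End FSpace.

Section TentSpace.
Variable R : realType.
Local Notation C := (Cplx R).

(* Nondegenerate arcs of the unit circle: the angles run from [arc_lo] to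
   [arc_hi], and the booleans tell whether each endpoint is included. *)
Record circle_arc := CircleArc {
  arc_lo : R;
  arc_hi : R;
  arc_lo_in : bool;
  arc_hi_in : bool;
  arc_lt : arc_lo < arc_hi;
  arc_le : arc_hi <= arc_lo + 2 * pi
}.

Definition arc_set (I : circle_arc) : set C :=
  [set Complex (cos t) (sin t) |
     t in [set` Interval (BSide (arc_lo_in I) (arc_lo I))
                         (BSide (~~ arc_hi_in I) (arc_hi I))]].

Definition arc_len (I : circle_arc) : R := (arc_hi I - arc_lo I) / (2 * pi).

Definition carleson_box (I : circle_arc) : set C :=
  [set z | 1 - arc_len I < cabs z < 1
           /\ arc_set I (z / Complex (cabs z) 0)].

Variable mu : {measure set (BorelC R) -> \bar R}.

Definition carleson_measure (s : R) : Prop :=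
  (ereal_sup [set mu (carleson_box I) * ((arc_len I `^ s)^-1)%:E
             | I in [set: circle_arc]] < +oo)%E.

(* The p-th power of the norm of T^oo_{p,s}(mu). *)
Definition T_norm_pow (p s : R) (f : C -> C) : \bar R :=
  ereal_sup [set (((arc_len I) `^ (- s))%:E *
      \int[mu]_(z in carleson_box I) ((cabs (f z)) `^ p)%:E)%E
    | I in [set: circle_arc]].

Definition T_norm (p s : R) (f : C -> C) : \bar R :=
  poweR (T_norm_pow p s f) p^-1.

Definition T_space (p s : R) : set (C -> C) :=
  [set f | measurable_fun (@disk R : set (BorelC R)) (f : BorelC R -> BorelC R)
           /\ (T_norm_pow p s f < +oo)%E].

Definition identity_bounded (p q s : R) : Prop :=
  exists2 K : R, 0 < K &
    forall f, F_space p q s f -> (T_norm p s f <= K%:E * F_norm p q s f)%E.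

(* [k] lists the indices of the subsequence. *)
Definition identity_compact (p q s : R) : Prop :=
  F_space p q s `<=` T_space p s /\
  forall f_ : nat -> C -> C,
    (forall n, F_space p q s (f_ n)) ->
    (exists M : R, forall n, (F_norm p q s (f_ n) <= M%:E)%E) ->
    exists k : nat -> nat, exists2 g : C -> C, T_space p s g &
      (forall m n, (m < n)%N -> (k m < k n)%N) /\
      T_norm p s (fun z => f_ (k n) z - g z) @[n --> \oo] --> (0 : \bar R)%E.

End TentSpace.

(* Main.v *)
Require Import Defs.
From HB Require Import structures.
From mathcomp Require Import all_boot all_order all_algebra.
From mathcomp Require Import complex.
From mathcomp Require Import all_classical all_reals all_analysis.
From mathcomp Require Import ring lra.
Import Order.TTheory GRing.Theory Num.Theory.
Import numFieldNormedType.Exports.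
Local Open Scope classical_set_scope.
Local Open Scope ring_scope.

(** Why the equivalence holds. Since alpha < 1, a function f of
    F(p, p alpha - 2, s) is bounded, and even uniformly continuous, up to the
    circle; so testing mu against F(p, p alpha - 2, s) amounts to testing it against
    constants. In one direction, the constant 1 has norm 1, and its tent
    norm is a power of the Carleson constant of mu, so
    each of boundedness and compactness makes mu an s-Carleson measure
    ([bounded_carleson], [compact_carleson]). In the other direction, if mu is
    s-Carleson then the tent norm of h is at most a constant times the
    supremum of |h| over the disc ([T_norm_le]); boundedness follows from a
    bound of sup |f| by the norm of f, and compactness from the fact that
    bounded sequences of the space have uniformly convergent subsequences.

    Both facts come from the growth estimate
    |f'(a)| <= c ||f|| (1 - |a|)^-alpha ([F_deriv_bound]). Integrated along radii,
    where (1 - t)^-alpha is integrable, it bounds f and gives a modulus of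
    continuity common to all functions of norm at most M
    ([growth_bounded], [growth_equicontinuous]); a uniformly convergent subsequence is
    then found by the argument of Arzela and Ascoli ([uniform_subsequence]).

    The growth estimate should be read as a mean value inequality
    |f'(a)|^p <= c r^-2 \int |f'|^p over the disc of radius r about a, with r a
    fixed fraction of 1 - |a|: there the weights of the seminorm are
    comparable to their values at a. It is proved for all p > 0 at once as follows. In that disc
    there is a point z at which |f'| dominates, up to a constant, its values on a
    whole disc about z, and for which the passage from a to z loses only
    a constant factor ([point_picking]). Cauchy's estimate then makes f' Lipschitz near z, so
    |f'| >= |f'(z)| / 2 on a square whose size is a fixed fraction of that of the
    disc about z ([deriv_large_on_square]), and the integral over this
    square is already large enough.

    Cauchy's estimate for functions that are only assumed to be complex
    differentiable at each point rests on Goursat's theorem ([goursat]), here derived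
    from a bisection principle for rectangles ([rect_cousin]), and
    on the integral of (f(z) - f(a)) / (z - a)^2 over the boundary of a square
    centred at a ([cauchy_estimate]). *)


Set Implicit Arguments.
Unset Strict Implicit.
Unset Printing Implicit Defensive.

(** * The modulus and rectangles of the complex plane *)

Section Modulus.
Variable R : realType.
Local Notation C := (Cplx R).
Implicit Types z w : C.

Lemma cabsE z : `|z| = (cabs z)%:C%C.
Proof. by case: z => x y. Qed.

Lemma cabs_ge0 z : 0 <= cabs z.
Proof. by case: z => x y; exact: sqrtr_ge0. Qed.

Lemma cabsD z w : cabs (z + w) <= cabs z + cabs w.
Proof. exact: le_normcD. Qed.

Lemma cabsN z : cabs (- z) = cabs z.
Proof. exact: normcN. Qed.

Lemma cabsB z w : cabs (z - w) <= cabs z + cabs w.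
Proof. by rewrite -(cabsN w); exact: cabsD. Qed.

Lemma cabsM z w : cabs (z * w) = cabs z * cabs w.
Proof. exact: ComplexField.Normc.normcM. Qed.

Lemma cabsV z : cabs (z^-1) = (cabs z)^-1.
Proof. exact: ComplexField.Normc.normcV. Qed.

Lemma cabsC z w : cabs (z - w) = cabs (w - z).
Proof. by rewrite -cabsN opprB. Qed.

Lemma cabs0 : cabs (0 : C) = 0.
Proof. exact: ComplexField.Normc.normc0. Qed.

Lemma cabs1 : cabs (1 : C) = 1.
Proof. exact: ComplexField.Normc.normc1. Qed.

Lemma cabs_gt0 z : z != 0 -> 0 < cabs z.
Proof.
move=> z0; rewrite lt_neqAle cabs_ge0 andbT eq_sym.
by apply: contra_neq z0 => /ComplexField.Normc.eq0_normc.
Qed.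

Lemma cabs_tri u z w : cabs (z - w) <= cabs (z - u) + cabs (u - w).
Proof. by have := cabsD (z - u) (u - w); rewrite addrA subrK. Qed.

Lemma cabs_real (x : R) : cabs (Complex x 0) = `|x|.
Proof. by rewrite /= expr0n addr0 sqrtr_sqr. Qed.

Lemma Re_le_cabs z : `|complex.Re z| <= cabs z.
Proof.
case: z => x y /=; rewrite -sqrtr_sqr ler_wsqrtr// lerDl sqr_ge0//.
Qed.

Lemma Im_le_cabs z : `|complex.Im z| <= cabs z.
Proof.
case: z => x y /=; rewrite -sqrtr_sqr ler_wsqrtr// lerDr sqr_ge0//.
Qed.

Lemma cabs_le_ReIm z : cabs z <= `|complex.Re z| + `|complex.Im z|.
Proof.
case: z => x y /=; rewrite -[leRHS]ger0_norm ?addr_ge0// -sqrtr_sqr.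
rewrite ler_wsqrtr// sqrrD !real_normK ?num_real//.
by rewrite lerD2r lerDl mulrn_wge0// mulr_ge0.
Qed.

Lemma nbhs_cabs (z : C) (P : set C) : nbhs z P <->
  exists2 d : R, 0 < d & forall w, cabs (w - z) < d -> P w.
Proof.
split.
  move/nbhs_ballP => [[d d'] /= d0 dP].
  move: d0; rewrite ltcE/= => /andP[/eqP ? d0]; subst d'.
  exists d => // w wz; apply: dP; rewrite /ball/= -normrN opprB.
  by change (`|w - z| < d%:C%C); rewrite cabsE ltcR.
move=> [d d0 dP]; apply/nbhs_ballP; exists (d%:C%C); first by rewrite /= ltcR.
move=> w; rewrite /ball/= -normrN opprB => wz; apply: dP.
by move: wz; change (`|w - z| < d%:C%C -> cabs (w - z) < d); rewrite cabsE ltcR.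
Qed.

End Modulus.

Section CousinRectangles.
Variable R : realType.

(** Bisection: were P to fail on the whole rectangle, it would fail on one of
    its quarters, then on a quarter of that one, and so on; the nested
    rectangles shrink to a point near which P holds. *)
Lemma rect_cousin (P : R -> R -> R -> R -> Prop) (x1 x2 y1 y2 : R) :
  x1 <= x2 -> y1 <= y2 ->
  (forall a b c d, a <= b -> c <= d ->
    P a ((a + b) / 2) c ((c + d) / 2) -> P ((a + b) / 2) b c ((c + d) / 2) ->
    P a ((a + b) / 2) ((c + d) / 2) d -> P ((a + b) / 2) b ((c + d) / 2) d ->
    P a b c d) ->
  (forall x y, x1 <= x <= x2 -> y1 <= y <= y2 -> exists2 e, 0 < e &
    forall a b c d, a <= x <= b -> c <= y <= d -> x1 <= a -> b <= x2 ->
      y1 <= c -> d <= y2 -> b - a < e -> d - c < e -> P a b c d) ->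
  P x1 x2 y1 y2.
Proof.
move=> x12 y12 quart loc; apply: contrapT => nP.
pose ok (r : R * R * R * R) := [/\ r.1.1.1 <= r.1.1.2, r.1.2 <= r.2 &
  ~ P r.1.1.1 r.1.1.2 r.1.2 r.2].
pose sub (r r' : R * R * R * R) := [/\ r.1.1.1 <= r'.1.1.1,
  r'.1.1.2 <= r.1.1.2, r.1.2 <= r'.1.2, r'.2 <= r.2 &
  r'.1.1.2 - r'.1.1.1 = (r.1.1.2 - r.1.1.1) / 2 /\
  r'.2 - r'.1.2 = (r.2 - r.1.2) / 2].
have step r : exists r', ok r -> ok r' /\ sub r r'.
  case: r => [[[a b] c] d]; have [|nok] := pselect (ok (a, b, c, d)); last first.
    by exists (a, b, c, d).
  move=> [/= ab cd nPr]; set m := (a + b) / 2; set n := (c + d) / 2.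
  have am : a <= m by rewrite /m; lra.
  have mb : m <= b by rewrite /m; lra.
  have cn : c <= n by rewrite /n; lra.
  have nd : n <= d by rewrite /n; lra.
  have [P1|P1] := pselect (P a m c n); last first.
    by exists (a, m, c, n); do !split => //=; rewrite /m /n; lra.
  have [P2|P2] := pselect (P m b c n); last first.
    by exists (m, b, c, n); do !split => //=; rewrite /m /n; lra.
  have [P3|P3] := pselect (P a m n d); last first.
    by exists (a, m, n, d); do !split => //=; rewrite /m /n; lra.
  have [P4|P4] := pselect (P m b n d); last first.
    by exists (m, b, n, d); do !split => //=; rewrite /m /n; lra.
  by exfalso; apply: nPr; apply: quart.
have [next nextP] := choice step.
pose s n := iter n next (x1, x2, y1, y2).
have sok n : ok (s n).
  by elim: n => [|n ih]; [split|have [] := nextP _ ih].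
have ssub n : sub (s n) (s n.+1) by have [] := nextP _ (sok n).
pose a n := (s n).1.1.1; pose b n := (s n).1.1.2.
pose c n := (s n).1.2; pose d n := (s n).2.
have nest (u v : nat -> R) : (forall n, u n <= v n) ->
    (forall n, u n <= u n.+1) -> (forall n, v n.+1 <= v n) ->
    exists x, forall n, u n <= x <= v n.
  move=> uv /nondecreasing_seqP nu /nonincreasing_seqP nv.
  have ubv n : ubound (range u) (v n).
    move=> _ [m _ <-]; have [mn|nm] := leqP m n.
      exact: le_trans (nu _ _ mn) (uv _).
    exact: le_trans (uv _) (nv _ _ (ltnW nm)).
  exists (sup (range u)) => n; apply/andP; split.
    by apply: ub_le_sup; [exists (v 0%N)|exists n].
  by apply: ge_sup; [exists (u 0%N), 0%N|exact: ubv].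
have [x xP] : exists x, forall n, a n <= x <= b n.
  by apply: nest => n; [case: (sok n)|case: (ssub n)|case: (ssub n)].
have [y yP] : exists y, forall n, c n <= y <= d n.
  by apply: nest => n; [case: (sok n)|case: (ssub n)|case: (ssub n)].
have [e e0 eP] := loc x y (xP 0%N) (yP 0%N).
have wab n : b n - a n = (x2 - x1) * (2 ^- n).
  elim: n => [|n ih]; first by rewrite expr0 invr1 mulr1.
  have [_ _ _ _ [-> _]] := ssub n.
  by rewrite -/(a n) -/(b n) ih exprS invfM; ring.
have wcd n : d n - c n = (y2 - y1) * (2 ^- n).
  elim: n => [|n ih]; first by rewrite expr0 invr1 mulr1.
  have [_ _ _ _ [_ ->]] := ssub n.
  by rewrite -/(c n) -/(d n) ih exprS invfM; ring.
have bnd n : [/\ x1 <= a n, b n <= x2, y1 <= c n & d n <= y2].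
  elim: n => [|n [h1 h2 h3 h4]]; first by split.
  have [k1 k2 k3 k4 _] := ssub n.
  by split; [exact: le_trans h1 k1|exact: le_trans k2 h2|
             exact: le_trans h3 k3|exact: le_trans k4 h4].
have M0 : 0 < (x2 - x1) + (y2 - y1) + 1 by lra.
have [n n0] : exists n, 2 ^- n < e / ((x2 - x1) + (y2 - y1) + 1).
  have eM0 : 0 < e / ((x2 - x1) + (y2 - y1) + 1) by rewrite divr_gt0.
  have [n _ /(_ n (leqnn n))] := near_infty_natSinv_expn_lt (PosNum eM0).
  by exists n; rewrite -[_ ^- _]div1r.
have p0 : 0 < 2 ^- n :> R by rewrite invr_gt0 exprn_gt0.
move: n0; rewrite ltr_pdivlMr// => n0.
have [_ _] := sok n; apply.
have [b1 b2 b3 b4] := bnd n.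
apply: eP => //.
- exact: xP.
- exact: yP.
- have := wab n; rewrite /a /b => ->; nra.
- have := wcd n; rewrite /c /d => ->; nra.
Qed.

End CousinRectangles.

(** * Complex differentiability and the mean value inequality *)

Section ComplexDerivative.
Variable R : realType.
Local Notation C := (Cplx R).
Local Notation "x %:C" := (real_complex R x).
Implicit Types (f : C -> C) (z w d : C).

(** f has the complex derivative d at z, in terms of the real-valued modulus; the
    norm on the complex plane takes its values in the plane itself. *)
Definition cdiff f z d := forall e : R, 0 < e -> exists2 r : R, 0 < r &
  forall w, cabs (w - z) < r ->
    cabs (f w - f z - d * (w - z)) <= e * cabs (w - z).

Lemma derivable_cdiff f z : derivable f z 1 -> cdiff f z (derive1 f z).
Proof.
rewrite derive1E => fz e e0.
have /cvgrPdist_le/(_ e%:C) : 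
    (fun h : C => h^-1 *: (f (h *: (1 : C) + z) - f z)) @ (0 : C)^' --> 'D_1 f z.
  exact: fz.
rewrite ltcR => /(_ e0); rewrite near_withinE => /nbhs_cabs[r r0 rP].
exists r => // w wr; have [->|wz] := eqVneq w z.
  by rewrite !subrr mulr0 subr0 cabs0 mulr0.
have wz0 : w - z != 0 by rewrite subr_eq0.
have := rP (w - z); rewrite subr0 => /(_ wr wz0).
rewrite /GRing.scale/= mulr1 subrK cabsE lecR => le_e.
have -> : f w - f z - 'D_1 f z * (w - z) =
    - ((w - z) * ('D_1 f z - (w - z)^-1 * (f w - f z))).
  by field.
by rewrite cabsN cabsM mulrC ler_wpM2r// cabs_ge0.
Qed.

Lemma cdiff_derivable f z (k : C) : cdiff f z k -> derivable f z 1.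
Proof.
move=> fk; apply: (cvgP k); apply/cvgrPdist_le => -[e e'].
rewrite ltcE/= => /andP[/eqP-> e0]; have [r r0 rP] := fk e e0.
rewrite near_withinE; apply/nbhs_cabs; exists r => // h; rewrite subr0 => hr h0.
have := rP (h + z); rewrite addrK => /(_ hr).
rewrite /GRing.scale/= mulr1 -[Complex e 0]/(e%:C) cabsE lecR => le_e.
have h1 := cabs_gt0 h0; rewrite -(ler_pM2r h1) -cabsM.
apply: le_trans le_e.
have -> : (k - h^-1 * (f (h + z) - f z)) * h = - (f (h + z) - f z - k * h).
  by field.
by rewrite cabsN.
Qed.

Lemma cdiffB f (g : C -> C) z (k l : C) : cdiff f z k -> cdiff g z l ->
  cdiff (fun w => f w - g w) z (k - l).
Proof.
move=> fk gl e e0; have e20 : 0 < e / 2 by rewrite divr_gt0.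
have [r r0 rP] := fk _ e20; have [s s0 sP] := gl _ e20.
exists (Num.min r s); first by rewrite lt_min r0.
move=> w; rewrite lt_min => /andP[/rP h1 /sP h2].
have -> : f w - g w - (f z - g z) - (k - l) * (w - z) =
  (f w - f z - k * (w - z)) - (g w - g z - l * (w - z)) by ring.
apply: le_trans (cabsB _ _) _; lra.
Qed.

Lemma cdiff_shift f (a z k : C) : cdiff f (a + z) k -> cdiff (fun w => f (a + w)) z k.
Proof.
move=> fk e /fk[r r0 rP]; exists r => // w.
have <- : a + w - (a + z) = w - z by ring.
exact: rP.
Qed.

Lemma cdiff_continuous f z d : cdiff f z d -> {for z, continuous f}.
Proof.
move=> /(_ 1 ltr01)[r r0 rP]; rewrite /prop_for/continuous_at.
move=> A /nbhs_cabs[e e0 eA].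
apply/nbhs_cabs; have k0 : 0 < 1 + cabs d by have := cabs_ge0 d; lra.
exists (Num.min r (e / (1 + cabs d))); first by rewrite lt_min r0 divr_gt0.
move=> w; rewrite lt_min ltr_pdivlMr// => /andP[wr we]; apply: eA.
have := cabsD (f w - f z - d * (w - z)) (d * (w - z)).
by rewrite subrK cabsM; have := rP _ wr; lra.
Qed.

Lemma continuous_cabsP f z : {for z, continuous f} <->
  (forall e, 0 < e -> exists2 r : R, 0 < r &
    forall w, cabs (w - z) < r -> cabs (f w - f z) < e).
Proof.
split=> [fz e e0|fz A /nbhs_cabs[e /fz[r r0 rP] eA]].
  have /fz/nbhs_cabs : nbhs (f z) [set w | cabs (w - f z) < e].
    by apply/nbhs_cabs; exists e.
  by move=> [r r0 rP]; exists r.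
by apply/nbhs_cabs; exists r => // w /rP /eA.
Qed.

Lemma is_derive_real (g : R -> R) (t l : R) :
  (forall e, 0 < e -> exists2 r, 0 < r & forall s, `|s - t| < r ->
    `|g s - g t - l * (s - t)| <= e * `|s - t|) ->
  is_derive t 1 g l.
Proof.
move=> gl.
have gcvg : h^-1 *: (g (h *: 1 + t) - g t) @[h --> 0^'] --> l.
  apply/cvgrPdist_le => e e0; have [r r0 rP] := gl e e0.
  rewrite near_withinE; apply/nbhs_ballP; exists r => // h.
  rewrite /ball/= sub0r normrN => hr h0.
  have := rP (h + t); rewrite addrK => /(_ hr).
  rewrite /GRing.scale/= mulr1 => le_e.
  rewrite -(ler_pM2r (_ : 0 < `|h|)) ?normr_gt0// -normrM.
  have -> : (l - h^-1 * (g (h + t) - g t)) * h = - (g (h + t) - g t - l * h).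
    by field.
  by rewrite normrN.
by apply: DeriveDef; [exact: (cvgP l)|exact: cvg_lim].
Qed.

Lemma cdiff_is_derive_Re f z v u d (t : R) : cdiff f (z + t%:C * v) d ->
  is_derive t 1 (fun s : R => complex.Re (u * f (z + s%:C * v)))
    (complex.Re (u * (d * v))).
Proof.
move=> fd; apply: is_derive_real => e e0.
have k0 : 0 < 1 + cabs u * cabs v by rewrite ltr_pwDl// mulr_ge0 ?cabs_ge0.
have v0 : 0 < 1 + cabs v by rewrite ltr_pwDl// cabs_ge0.
have [r r0 rP] := fd (e / (1 + cabs u * cabs v)) (divr_gt0 e0 k0).
exists (r / (1 + cabs v)); first exact: divr_gt0.
move=> s; rewrite ltr_pdivlMr// => st.
have sv : (z + s%:C * v) - (z + t%:C * v) = (s - t)%:C * v.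
  by rewrite rmorphB/=; ring.
have := rP (z + s%:C * v); rewrite sv cabsM cabs_real => /(_ _).
have svr : `|s - t| * cabs v < r.
  by apply: le_lt_trans st; rewrite ler_wpM2l// lerDr.
move=> /(_ svr) h.
set A := u * _; set B := u * _; set D := u * _.
have -> : complex.Re A - complex.Re B - complex.Re D * (s - t) =
    complex.Re (A - B - D * (s - t)%:C).
  case: A => a1 a2; case: B => b1 b2; case: D => d1 d2 /=.
  by rewrite mulr0 subr0.
apply: le_trans (Re_le_cabs _) _.
have -> : A - B - D * (s - t)%:C =
    u * (f (z + s%:C * v) - f (z + t%:C * v) - d * ((s - t)%:C * v)).
  by rewrite /A /B /D; ring.
rewrite cabsM; apply: le_trans (ler_wpM2l (cabs_ge0 u) h) _.
have -> : cabs u * (e / (1 + cabs u * cabs v) * (`|s - t| * cabs v)) =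
  (e * `|s - t|) * ((cabs u * cabs v) / (1 + cabs u * cabs v)) by ring.
apply: ler_piMr; first by rewrite mulr_ge0 // ltW.
by rewrite ler_pdivrMr// mul1r lerDr.
Qed.

Lemma phase z : exists2 u : C, cabs u <= 1 & complex.Re (u * z) = cabs z.
Proof.
have [->|z0] := eqVneq z 0; first by exists 0; rewrite ?mulr0 ?cabs0.
have c0 := @cabs_gt0 _ _ z0.
exists (conjc z * (cabs z)^-1%:C).
  rewrite cabsM cabs_real ger0_norm ?invr_ge0 ?cabs_ge0//.
  have -> : cabs (conjc z) = cabs z by case: (z) => x y /=; rewrite sqrrN.
  by rewrite divff ?gt_eqF.
have : cabs z ^+ 2 = complex.Re (conjc z * z).
  case: (z) => x y /=; rewrite sqr_sqrtr ?addr_ge0 ?sqr_ge0//; ring.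
have -> : complex.Re (conjc z * (cabs z)^-1%:C * z) =
    complex.Re (conjc z * z) / cabs z.
  by case: (z) (_^-1) => x y k /=; ring.
by move=> <-; rewrite expr2 mulfK ?gt_eqF.
Qed.

(** Comparison form of the mean value inequality: testing f against a
    constant of modulus at most 1 reduces it to the real mean value theorem. *)
Lemma cmean_value f (df : R -> C) z v (psi dpsi : R -> R) (a b : R) : a <= b ->
  (forall t, a <= t <= b -> cdiff f (z + t%:C * v) (df t)) ->
  (forall t, a < t < b -> is_derive t 1 psi (dpsi t)) ->
  {within `[a, b], continuous psi} ->
  (forall t, a < t < b -> cabs (df t * v) <= dpsi t) ->
  cabs (f (z + b%:C * v) - f (z + a%:C * v)) <= psi b - psi a.
Proof.
move=> ab fd pd pc le_d.
have [u u1 uE] := phase (f (z + b%:C * v) - f (z + a%:C * v)).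
pose g s := complex.Re (u * f (z + s%:C * v)).
have gd t : a <= t <= b -> is_derive t 1 g (complex.Re (u * (df t * v))).
  by move=> tab; exact/cdiff_is_derive_Re/fd.
have gc : {within `[a, b], continuous g}.
  apply: derivable_within_continuous => t; rewrite in_itv/= => tab.
  by have [] := gd t tab.
have gpc : {within `[a, b], continuous (g - psi)}.
  move=> t; apply: (@continuousB _ R^o); [exact: gc|exact: pc].
have gpd t : t \in `]a, b[ ->
    is_derive t 1 (g - psi) (complex.Re (u * (df t * v)) - dpsi t).
  rewrite in_itv/= => /andP[a_t t_b].
  have := gd t; rewrite !ltW// => /(_ isT) ?.
  have : is_derive t 1 psi (dpsi t) by apply: pd; rewrite a_t.
  by move=> ?; exact: is_deriveB.
have gE : g b - g a = cabs (f (z + b%:C * v) - f (z + a%:C * v)).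
  by rewrite -uE /g mulrBr; case: (u * _) (u * _) => ? ? [? ?].
rewrite -gE; move: ab; rewrite le_eqVlt => /predU1P[->|ab].
  by rewrite !subrr.
have [c cab] := MVT ab gpd gpc.
have -> : (g - psi) b - (g - psi) a = (g b - g a) - (psi b - psi a).
  by change ((g b - psi b) - (g a - psi a) = (g b - g a) - (psi b - psi a)); ring.
move: cab; rewrite in_itv/= => cab gE2.
suff : (g b - g a) - (psi b - psi a) <= 0 by lra.
rewrite gE2; apply: mulr_le0_ge0; last by rewrite subr_ge0 ltW.
rewrite subr_le0.
apply: le_trans (le_d _ cab); apply: le_trans (ler_norm _) _.
apply: le_trans (Re_le_cabs _) _.
by rewrite cabsM ler_piMl// cabs_ge0.
Qed.

Lemma cmean_value_Lip f df z w (S : R) :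
  (forall t, 0 <= t <= 1 -> cdiff f (z + t%:C * (w - z)) (df t)) ->
  (forall t, 0 <= t <= 1 -> cabs (df t) <= S) ->
  cabs (f w - f z) <= S * cabs (w - z).
Proof.
move=> fd dS; pose psi (t : R) := (S * cabs (w - z)) * t.
have := @cmean_value f df z (w - z) psi (cst (S * cabs (w - z))) 0 1 ler01 fd.
have -> : z + 0%:C * (w - z) = z by rewrite rmorph0 mul0r addr0.
have -> : z + 1%:C * (w - z) = w by rewrite rmorph1 mul1r subrKC.
have -> : psi 1 - psi 0 = S * cabs (w - z) by rewrite /psi; ring.
apply.
- move=> t _; rewrite -[cst _ t]/(S * cabs (w - z)).
  rewrite -[X in is_derive _ _ _ X]mulr1; apply: is_deriveZ.
- apply: derivable_within_continuous => t _.
  exact: derivableZ.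
- move=> t /andP[t0 t1]; rewrite cabsM ler_wpM2r ?cabs_ge0// dS//.
  by rewrite !ltW.
Qed.

End ComplexDerivative.

(** * Integrals of continuous complex functions of a real variable *)

Section RealIntegral.
Variable R : realType.
Local Notation leb := (@lebesgue_measure R).
Implicit Types (g h : R -> R) (a b c : R).

Definition rint g a b : R := \int[leb]_(x in `[a, b]) g x.

Definition rcont g a b := forall t, a <= t <= b -> {for t, continuous g}.

Lemma rcont_within g a b : rcont g a b -> {within `[a, b], continuous g}.
Proof.
by move=> gc; apply: continuous_in_subspaceT => t; rewrite inE/= in_itv/= => /gc.
Qed.

Lemma rcont_integrable g a b : rcont g a b -> leb.-integrable `[a, b] (EFin \o g).
Proof.
move=> gc; apply: continuous_compact_integrable; first exact: segment_compact.
exact: rcont_within.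
Qed.

Lemma rintD g h a b : rcont g a b -> rcont h a b ->
  rint (fun t => g t + h t) a b = rint g a b + rint h a b.
Proof. by move=> gc hc; rewrite /rint RintegralD//; exact: rcont_integrable. Qed.

Lemma rintZ k g a b : rcont g a b ->
  rint (fun t => k * g t) a b = k * rint g a b.
Proof. by move=> gc; rewrite /rint RintegralZl//; exact: rcont_integrable. Qed.

Lemma rint_split g a b c : a <= b -> b <= c -> rcont g a c ->
  rint g a c = rint g a b + rint g b c.
Proof.
move=> ab bc /rcont_integrable gi.
have := @Rintegral_itvB R g (BLeft a) (BRight c) b gi.
rewrite !bnd_simp => /(_ ab bc).
rewrite Rintegral_itv_obnd_cbnd.
  by rewrite /rint => <-; rewrite subrKC.
apply: integrableS gi => //; apply: subset_itvr.
by rewrite bnd_simp.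
Qed.

Lemma rint_bound g a b (M : R) : a <= b -> rcont g a b ->
  (forall t, a <= t <= b -> `|g t| <= M) -> `|rint g a b| <= M * (b - a).
Proof.
move=> ab gc gM; have gi := rcont_integrable gc.
apply: le_trans (le_normr_Rintegral _ gi) _ => //.
have -> : M * (b - a) = \int[leb]_(x in `[a, b]) M.
  have E : leb [set` `[a, b]] = (b - a)%:E.
    rewrite lebesgue_measure_itv/= lte_fin.
    move: ab; rewrite le_eqVlt => /predU1P[->|->]; last by [].
    by rewrite ltxx subrr.
  by rewrite Rintegral_cst//; congr (M * _); rewrite -[LHS]/(fine (b - a)%:E) -E.
apply: le_Rintegral => //.
- exact: integrable_norm gi.
- by apply: (@rcont_integrable (cst M)) => t _; exact: cvg_cst.
Qed.

Lemma rint_FTC g G a b : a <= b -> rcont g a b ->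
  (forall t, a <= t <= b -> is_derive t 1 G (g t)) ->
  rint g a b = G b - G a.
Proof.
rewrite le_eqVlt => /predU1P[->|ab] gc Gg.
  by rewrite /rint set_itv1 Rintegral_set1 subrr.
have Gcont t : a <= t <= b -> {for t, continuous G}.
  move=> /Gg[dG _]; exact/differentiable_continuous/derivable1_diffP.
rewrite /rint /Rintegral (@continuous_FTC2 _ g G)//.
- exact: rcont_within.
- split.
  + by move=> t; rewrite in_itv/= => /andP[at_ tb]; have [] := Gg t; rewrite ?ltW.
  + apply: cvg_at_right_filter; apply: Gcont; by rewrite lexx ltW.
  + apply: cvg_at_left_filter; apply: Gcont; by rewrite lexx ltW.
- move=> t; rewrite in_itv/= => /andP[at_ tb]; rewrite derive1E.
  by have [] := Gg t; rewrite ?ltW.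
Qed.

Lemma rint_ge g a b (M : R) : a <= b -> rcont g a b ->
  (forall t, a <= t <= b -> M <= g t) -> M * (b - a) <= rint g a b.
Proof.
move=> ab gc gM.
have Mc : rcont (fun _ => M) a b by move=> t _; exact: cvg_cst.
have <- : rint (fun _ => M) a b = M * (b - a).
  have := @rint_FTC (fun _ => M) (fun t => M * t) a b ab Mc.
  rewrite -mulrBr; apply=> t _.
  rewrite -[X in is_derive _ _ _ X]mulr1; exact: is_deriveZ.
apply: le_Rintegral; [by []|exact: rcont_integrable|exact: rcont_integrable|].
by move=> t /=; rewrite in_itv/=; exact: gM.
Qed.

End RealIntegral.

Section ComplexIntegral.
Variable R : realType.
Local Notation C := (Cplx R).
Local Notation "x %:C" := (real_complex R x).
Implicit Types (u v : R -> C) (a b c : R) (k : C).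

Definition ccont u a b := forall t, a <= t <= b -> forall e, 0 < e ->
  exists2 r, 0 < r & forall s, `|s - t| < r -> cabs (u s - u t) < e.

Definition cint u a b : C :=
  Complex (rint (fun t => complex.Re (u t)) a b)
          (rint (fun t => complex.Im (u t)) a b).

Lemma ccontP u a b : ccont u a b <->
  rcont (fun t => complex.Re (u t)) a b /\ rcont (fun t => complex.Im (u t)) a b.
Proof.
split=> [uc|[rc ic]].
  split=> t tab; apply/cvgrPdist_lt => e /(uc t tab)[r r0 rP].
    apply/nbhs_ballP; exists r => // s; rewrite /ball/= distrC => /rP.
    apply: le_lt_trans; apply: le_trans (Re_le_cabs _).
    by rewrite distrC; case: (u s) (u t) => ? ? [? ?].
  apply/nbhs_ballP; exists r => // s; rewrite /ball/= distrC => /rP.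
  apply: le_lt_trans; apply: le_trans (Im_le_cabs _).
  by rewrite distrC; case: (u s) (u t) => ? ? [? ?].
move=> t tab e e0; have e20 : 0 < e / 2 by rewrite divr_gt0.
have /cvgrPdist_lt/(_ _ e20)/nbhs_ballP[r r0 rP] := rc t tab.
have /cvgrPdist_lt/(_ _ e20)/nbhs_ballP[r' r'0 r'P] := ic t tab.
exists (Num.min r r'); first by rewrite lt_min r0.
move=> s; rewrite lt_min distrC => /andP[/rP + /r'P].
move=> h1 h2; apply: le_lt_trans (cabs_le_ReIm _) _.
rewrite [ltRHS]splitr ltrD//.
  by move: h1; rewrite /= distrC; case: (u s) (u t) => ? ? [? ?].
by move: h2; rewrite /= distrC; case: (u s) (u t) => ? ? [? ?].
Qed.

Lemma cintD u v a b : ccont u a b -> ccont v a b ->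
  cint (fun t => u t + v t) a b = cint u a b + cint v a b.
Proof.
move=> /ccontP[ur ui] /ccontP[vr vi]; rewrite /cint.
have E : forall z w : C, complex.Re (z + w) = complex.Re z + complex.Re w /\
  complex.Im (z + w) = complex.Im z + complex.Im w by case=> ? ? [? ?].
rewrite [LHS](_ : _ = Complex (rint (fun t => complex.Re (u t) + complex.Re (v t)) a b)
  (rint (fun t => complex.Im (u t) + complex.Im (v t)) a b)).
  by rewrite !rintD.
by congr (Complex (rint _ _ _) (rint _ _ _)); apply/funext => t; have [] := E (u t) (v t).
Qed.

Lemma cintZ k u a b : ccont u a b ->
  cint (fun t => k * u t) a b = k * cint u a b.
Proof.
move=> /ccontP[ur ui]; rewrite /cint; case: k => x y.
have cZ g l : rcont g a b -> rcont (fun t => l * g t) a b.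
  by move=> gc t /gc gt; apply: cvgM => //; exact: cvg_cst.
rewrite [LHS](_ : _ = Complex
  (rint (fun t => x * complex.Re (u t) + (- y) * complex.Im (u t)) a b)
  (rint (fun t => x * complex.Im (u t) + y * complex.Re (u t)) a b)).
  rewrite !rintD ?rintZ//; try exact: cZ.
  by rewrite [RHS]/GRing.mul/=; congr Complex; ring.
congr (Complex (rint _ _ _) (rint _ _ _)); apply/funext => t;
  case: (u t) => ? ? /=; ring.
Qed.

Lemma ccontZ k u a b : ccont u a b -> ccont (fun t => k * u t) a b.
Proof.
move=> uc t tab e e0; have k0 : 0 < 1 + cabs k by rewrite ltr_pwDl// cabs_ge0.
have [r r0 rP] := uc t tab (e / (1 + cabs k)) (divr_gt0 e0 k0).
exists r => // s /rP; rewrite ltr_pdivlMr// -mulrBr cabsM => h.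
apply: le_lt_trans h; rewrite mulrDr mulr1 mulrC lerDr; exact: cabs_ge0.
Qed.

Lemma cintB u v a b : ccont u a b -> ccont v a b ->
  cint (fun t => u t - v t) a b = cint u a b - cint v a b.
Proof.
move=> uc vc; rewrite -[X in _ = _ + X]mulN1r -cintZ// -cintD//; last exact: ccontZ.
by congr cint; apply/funext => t; rewrite mulN1r.
Qed.

Lemma cint_split u a b c : a <= b -> b <= c -> ccont u a c ->
  cint u a c = cint u a b + cint u b c.
Proof.
move=> ab bc /ccontP[ur ui].
by rewrite /cint (rint_split ab bc ur) (rint_split ab bc ui).
Qed.

Lemma cint_bound u a b (M : R) : a <= b -> ccont u a b ->
  (forall t, a <= t <= b -> cabs (u t) <= M) -> cabs (cint u a b) <= 2 * M * (b - a).
Proof.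
move=> ab /ccontP[ur ui] uM; apply: le_trans (cabs_le_ReIm _) _ => /=.
rewrite -mulrA [leRHS]mulr_natl mulr2n; apply: lerD; apply: rint_bound => // t /uM;
  apply: le_trans; [exact: Re_le_cabs|exact: Im_le_cabs].
Qed.

Lemma cint_FTC (F : C -> C) (z v : C) (d : R -> C) a b : a <= b ->
  ccont (fun t => d t * v) a b ->
  (forall t, a <= t <= b -> cdiff F (z + t%:C * v) (d t)) ->
  cint (fun t => d t * v) a b = F (z + b%:C * v) - F (z + a%:C * v).
Proof.
move=> ab /ccontP[dr di] Fd; rewrite /cint.
have -> : rint (fun t => complex.Re (d t * v)) a b =
    complex.Re (F (z + b%:C * v)) - complex.Re (F (z + a%:C * v)).
  have := @rint_FTC _ _ (fun t => complex.Re (1 * F (z + t%:C * v))) _ _ ab dr.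
  rewrite !mul1r; apply=> t /Fd /(@cdiff_is_derive_Re _ F z v 1).
  by rewrite mul1r.
have ImE (w : C) : complex.Im w = complex.Re (- 'i%C * w).
  by case: w => x y /=; ring.
have -> : rint (fun t => complex.Im (d t * v)) a b =
    complex.Im (F (z + b%:C * v)) - complex.Im (F (z + a%:C * v)).
  rewrite !ImE.
  apply: (@rint_FTC _ _ (fun t => complex.Re (- 'i%C * F (z + t%:C * v)))) => //.
  by move=> t /Fd /(@cdiff_is_derive_Re _ F z v (- 'i%C)); rewrite -ImE.
by case: (F (z + b%:C * v)) (F (z + a%:C * v)) => ? ? [? ?].
Qed.

End ComplexIntegral.

(** * Goursat's theorem on rectangles *)

Section RectangleContour.
Variable R : realType.
Local Notation C := (Cplx R).
Local Notation "x %:C" := (real_complex R x).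
Implicit Types (h f : C -> C) (a b c d x y : R) (k z w : C).

(** The integral of h(z) dz over the boundary of [a, b] x [c, d], anticlockwise. *)
Definition oint h a b c d : C :=
  cint (fun t => h (Complex t c)) a b - cint (fun t => h (Complex t d)) a b +
  'i%C * (cint (fun t => h (Complex b t)) c d - cint (fun t => h (Complex a t)) c d).

Definition on_rect a b c d (P : C -> Prop) := forall x y,
  a <= x <= b -> c <= y <= d -> P (Complex x y).

(** The boundary of the rectangle: a kernel with a pole inside is continuous
    there, which is all that contour integrals ask for. *)
Definition on_frame a b c d (P : C -> Prop) := forall x y,
  a <= x <= b -> c <= y <= d -> [\/ x = a, x = b, y = c | y = d] ->
  P (Complex x y).

Definition cont_at h z := {for z, continuous h}.

Lemma on_rect_frame a b c d P : on_rect a b c d P -> on_frame a b c d P.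
Proof. by move=> rP x y xab ycd _; exact: rP. Qed.

Lemma on_rectS a b c d a' b' c' d' P : a <= a' -> b' <= b -> c <= c' -> d' <= d ->
  on_rect a b c d P -> on_rect a' b' c' d' P.
Proof.
move=> aa bb cc dd rP x y /andP[ax xb] /andP[cy yd]; apply: rP.
  by rewrite (le_trans aa ax) (le_trans xb bb).
by rewrite (le_trans cc cy) (le_trans yd dd).
Qed.

Lemma ccont_edges h a b c d : a <= b -> c <= d ->
  on_frame a b c d (cont_at h) ->
  [/\ ccont (fun t => h (Complex t c)) a b, ccont (fun t => h (Complex t d)) a b,
      ccont (fun t => h (Complex b t)) c d & ccont (fun t => h (Complex a t)) c d].
Proof.
move=> ab cd hc; split=> t tI e e0.
- have /continuous_cabsP/(_ e e0)[r r0 rP] : cont_at h (Complex t c).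
    by apply: hc => //; [rewrite lexx|constructor 3].
  exists r => // s st; apply: rP.
  by rewrite -[_ - _]/(Complex (s - t) (c - c)) subrr cabs_real.
- have /continuous_cabsP/(_ e e0)[r r0 rP] : cont_at h (Complex t d).
    by apply: hc => //; [rewrite lexx andbT|constructor 4].
  exists r => // s st; apply: rP.
  by rewrite -[_ - _]/(Complex (s - t) (d - d)) subrr cabs_real.
- have /continuous_cabsP/(_ e e0)[r r0 rP] : cont_at h (Complex b t).
    by apply: hc => //; [rewrite lexx andbT|constructor 2].
  exists r => // s st; apply: rP.
  rewrite -[_ - _]/(Complex (b - b) (s - t)) subrr /= expr0n add0r.
  by rewrite sqrtr_sqr.
- have /continuous_cabsP/(_ e e0)[r r0 rP] : cont_at h (Complex a t).
    by apply: hc => //; [rewrite lexx|constructor 1].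
  exists r => // s st; apply: rP.
  rewrite -[_ - _]/(Complex (a - a) (s - t)) subrr /= expr0n add0r.
  by rewrite sqrtr_sqr.
Qed.

Lemma ointB h1 h2 a b c d : a <= b -> c <= d ->
  on_frame a b c d (cont_at h1) -> on_frame a b c d (cont_at h2) ->
  oint (fun z => h1 z - h2 z) a b c d = oint h1 a b c d - oint h2 a b c d.
Proof.
move=> ab cd /(ccont_edges ab cd)[? ? ? ?] /(ccont_edges ab cd)[? ? ? ?].
rewrite /oint !cintB//; ring.
Qed.

Lemma ointZ h k a b c d : a <= b -> c <= d ->
  on_frame a b c d (cont_at h) ->
  oint (fun z => k * h z) a b c d = k * oint h a b c d.
Proof.
move=> ab cd /(ccont_edges ab cd)[? ? ? ?].
rewrite /oint !cintZ//; ring.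
Qed.

Lemma oint_bound h a b c d (M : R) : a <= b -> c <= d ->
  on_frame a b c d (cont_at h) ->
  on_frame a b c d (fun z => cabs (h z) <= M) ->
  cabs (oint h a b c d) <= 4 * M * ((b - a) + (d - c)).
Proof.
move=> ab cd /(ccont_edges ab cd)[c1 c2 c3 c4] hM.
have b1 : cabs (cint (fun t => h (Complex t c)) a b) <= 2 * M * (b - a).
  by apply: cint_bound => // t tI; apply: hM => //; [rewrite lexx|constructor 3].
have b2 : cabs (cint (fun t => h (Complex t d)) a b) <= 2 * M * (b - a).
  by apply: cint_bound => // t tI; apply: hM => //; [rewrite lexx andbT|constructor 4].
have b3 : cabs (cint (fun t => h (Complex b t)) c d) <= 2 * M * (d - c).
  by apply: cint_bound => // t tI; apply: hM => //; [rewrite lexx andbT|constructor 2].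
have b4 : cabs (cint (fun t => h (Complex a t)) c d) <= 2 * M * (d - c).
  by apply: cint_bound => // t tI; apply: hM => //; [rewrite lexx|constructor 1].
have i1 : cabs ('i%C : C) = 1 by rewrite /= expr0n expr1n add0r sqrtr1.
apply: le_trans (cabsD _ _) _; rewrite cabsM i1 mul1r.
apply: le_trans (lerD (cabsB _ _) (cabsB _ _)) _.
lra.
Qed.

Lemma oint_splitx h a m b c d : a <= m -> m <= b -> c <= d ->
  on_frame a b c d (cont_at h) ->
  oint h a b c d = oint h a m c d + oint h m b c d.
Proof.
move=> am mb cd hc; have ab := le_trans am mb.
have [c1 c2 c3 c4] := ccont_edges ab cd hc.
rewrite /oint (cint_split am mb c1) (cint_split am mb c2); ring.
Qed.

Lemma oint_splity h a b c n d : a <= b -> c <= n -> n <= d ->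
  on_frame a b c d (cont_at h) ->
  oint h a b c d = oint h a b c n + oint h a b n d.
Proof.
move=> ab cn nd hc; have cd := le_trans cn nd.
have [c1 c2 c3 c4] := ccont_edges ab cd hc.
rewrite /oint (cint_split cn nd c3) (cint_split cn nd c4); ring.
Qed.

Lemma cdiff_quadratic (p q : C) z :
  cdiff (fun w => p * w + q * w ^+ 2 / 2 : C) z (p + q * z).
Proof.
move=> e e0; have q0 : 0 < 1 + cabs q by rewrite ltr_pwDl// cabs_ge0.
exists (e / (1 + cabs q)); first exact: divr_gt0.
move=> w; rewrite ltr_pdivlMr// => wz.
have -> : p * w + q * w ^+ 2 / 2 - (p * z + q * z ^+ 2 / 2) -
    (p + q * z) * (w - z) = (q / 2 * (w - z)) * (w - z) by field.
rewrite cabsM ler_wpM2r ?cabs_ge0// !cabsM cabsV.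
have -> : cabs (2 : C) = 2 by rewrite /= addr0 expr0n addr0 sqrtr_sqr ger0_norm.
have := cabs_ge0 q; have := cabs_ge0 (w - z); nra.
Qed.

Lemma cont_affine (p q : C) z : cont_at (fun w => p + q * w) z.
Proof.
apply: (@cdiff_continuous _ _ _ q) => e e0; exists 1 => // w _.
have -> : p + q * w - (p + q * z) - q * (w - z) = 0 by ring.
by rewrite cabs0 mulr_ge0 ?cabs_ge0// ltW.
Qed.

Lemma oint_affine (p q : C) a b c d : a <= b -> c <= d ->
  oint (fun w => p + q * w) a b c d = 0.
Proof.
move=> ab cd.
have [c1 c2 c3 c4] := @ccont_edges (fun w => p + q * w) a b c d ab cd
  (fun x y _ _ _ => @cont_affine p q (Complex x y)).
pose F w : C := p * w + q * w ^+ 2 / 2.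
have hor y : ccont (fun t => p + q * Complex t y) a b ->
    cint (fun t => p + q * Complex t y) a b = F (Complex b y) - F (Complex a y).
  move=> cy; have E t : Complex t y = Complex 0 y + t%:C * 1 :> C.
    by rewrite mulr1; apply/eqP; rewrite eq_complex /= add0r addr0 !eqxx.
  have := @cint_FTC _ F (Complex 0 y) 1 (fun t => p + q * Complex t y) a b ab.
  rewrite -!E => <-.
  - by congr cint; apply/funext => t; rewrite mulr1.
  - by under eq_fun do rewrite mulr1.
  - by move=> t _; rewrite -E; exact: cdiff_quadratic.
have ver x : ccont (fun t => p + q * Complex x t) c d ->
    'i%C * cint (fun t => p + q * Complex x t) c d = F (Complex x d) - F (Complex x c).
  move=> cx; have E t : Complex x t = Complex x 0 + t%:C * 'i%C :> C.
    by apply/eqP; rewrite eq_complex /= !(mulr0, mul0r, mulr1, addr0, add0r, subr0) !eqxx.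
  have ci := ccontZ 'i%C cx.
  have := @cint_FTC _ F (Complex x 0) 'i%C (fun t => p + q * Complex x t) c d cd.
  rewrite -!E => <-.
  - by rewrite -cintZ//; congr cint; apply/funext => t; rewrite mulrC.
  - by under eq_fun do rewrite mulrC.
  - by move=> t _; rewrite -E; exact: cdiff_quadratic.
by rewrite /oint mulrBr !hor// !ver//; ring.
Qed.

(** An affine function has contour integral 0; hence near a point where h is
    differentiable the integral of h over a small rectangle is at most e times
    the square of the half-perimeter, and such a bound passes from the quarters of a
    rectangle to the rectangle. *)
Lemma goursat h a b c d : a <= b -> c <= d ->
  on_rect a b c d (fun z => exists k, cdiff h z k) -> oint h a b c d = 0.
Proof.
move=> ab cd hd.
have hc : on_rect a b c d (cont_at h).
  by move=> x y xI yI; have [k /cdiff_continuous] := hd x y xI yI.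
suff small e : 0 < e -> cabs (oint h a b c d) <= e * ((b - a) + (d - c)) ^+ 2.
  apply: contrapT => /eqP/cabs_gt0 o0.
  set s := (b - a) + (d - c) in small.
  have s0 : 0 <= s ^+ 2 by exact: sqr_ge0.
  have s1 : 0 < 1 + s ^+ 2 by lra.
  have := small _ (divr_gt0 o0 (mulr_gt0 (ltr0n _ 2) s1)).
  apply/negP; rewrite -ltNge -mulrA gtr_pMr// mulrC ltr_pdivrMr ?mulr_gt0//.
  lra.
move=> e0.
pose P x1 x2 y1 y2 := a <= x1 -> x2 <= b -> c <= y1 -> y2 <= d ->
  cabs (oint h x1 x2 y1 y2) <= e * ((x2 - x1) + (y2 - y1)) ^+ 2.
apply: (@rect_cousin R P a b c d) => //.
- move=> x1 x2 y1 y2 x12 y12; set m := (x1 + x2) / 2; set n := (y1 + y2) / 2.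
  have x1m : x1 <= m by rewrite /m; lra.
  have mx2 : m <= x2 by rewrite /m; lra.
  have y1n : y1 <= n by rewrite /n; lra.
  have ny2 : n <= y2 by rewrite /n; lra.
  move=> P1 P2 P3 P4 ax xb cy yd.
  have := P1 ax (le_trans mx2 xb) cy (le_trans ny2 yd).
  have := P2 (le_trans ax x1m) xb cy (le_trans ny2 yd).
  have := P3 ax (le_trans mx2 xb) (le_trans cy y1n) yd.
  have := P4 (le_trans ax x1m) xb (le_trans cy y1n) yd.
  have hc' := on_rectS ax xb cy yd hc.
  rewrite (oint_splity x12 y1n ny2 (on_rect_frame hc')).
  rewrite (oint_splitx x1m mx2 y1n
    (on_rect_frame (on_rectS (lexx _) (lexx _) (lexx _) ny2 hc'))).
  rewrite (oint_splitx x1m mx2 ny2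
    (on_rect_frame (on_rectS (lexx _) (lexx _) y1n (lexx _) hc'))).
  set o1 := oint _ _ _ _ _; set o2 := oint _ _ _ _ _; set o3 := oint _ _ _ _ _.
  set o4 := oint _ _ _ _ _ => h4 h3 h2 h1.
  apply: le_trans (cabsD _ _) _; apply: le_trans (lerD (cabsD _ _) (cabsD _ _)) _.
  have -> : e * (x2 - x1 + (y2 - y1)) ^+ 2 = 4 * (e * (m - x1 + (n - y1)) ^+ 2).
    by rewrite /m /n; field.
  move: h1 h2 h3 h4.
  have -> : x2 - m = m - x1 by rewrite /m; field.
  have -> : y2 - n = n - y1 by rewrite /n; field.
  lra.
- move=> x y xI yI; have [k hk] := hd x y xI yI.
  have e40 : 0 < e / 4 by rewrite divr_gt0.
  have [r r0 rP] := hk _ e40; exists (r / 2); first by rewrite divr_gt0.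
  move=> x1 x2 y1 y2 /andP[x1x xx2] /andP[y1y yy2] _ _ _ _ sx sy ax xb cy yd.
  have x12 := le_trans x1x xx2; have y12 := le_trans y1y yy2.
  have hc' := on_rect_frame (on_rectS ax xb cy yd hc).
  pose z : C := Complex x y.
  have ac w : cont_at (fun w => (h z - k * z) + k * w) w by exact: cont_affine.
  have fc : on_frame x1 x2 y1 y2 (cont_at (fun w => (h z - k * z) + k * w)).
    by move=> u v _ _ _; exact: ac.
  pose F w := h w - (h z - k * z + k * w).
  have <- : oint F x1 x2 y1 y2 = oint h x1 x2 y1 y2.
    by rewrite /F ointB// oint_affine// subr0.
  have Fc : on_frame x1 x2 y1 y2 (cont_at F).
    move=> u v uI vI uv; apply: (@continuousB _ C C h (fun w => h z - k * z + k * w)).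
      exact: hc'.
    exact: ac.
  set s := x2 - x1 + (y2 - y1).
  have FM : on_frame x1 x2 y1 y2 (fun w => cabs (F w) <= e / 4 * s).
    move=> u v /andP[x1u ux2] /andP[y1v vy2] _.
    have wz : cabs (Complex u v - z) <= s.
      apply: le_trans (cabs_le_ReIm _) _; apply: lerD => /=.
        by rewrite ler_norml; apply/andP; split; lra.
      by rewrite ler_norml; apply/andP; split; lra.
    have -> : F (Complex u v) = h (Complex u v) - h z - k * (Complex u v - z).
      by rewrite /F; ring.
    apply: le_trans (rP _ _) _; first by apply: le_lt_trans wz _; rewrite /s; lra.
    by rewrite ler_wpM2l// ltW.
  have := oint_bound x12 y12 Fc FM; rewrite -/s => b1.
  by apply: le_trans b1 _; lra.
Qed.

End RectangleContour.

(** * Deformation to a small square *)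

Section WindingAndDeformation.
Variable R : realType.
Local Notation C := (Cplx R).
Local Notation "x %:C" := (real_complex R x).
Implicit Types (f g h : C -> C) (a b c d t x y : R) (k z w : C).

Lemma frame_ge t x y : 0 < t -> [\/ x = - t, x = t, y = - t | y = t] ->
  t <= cabs (Complex x y : C).
Proof.
move=> t0 [] ->.
- by apply: le_trans (Re_le_cabs _); rewrite /= normrN (ger0_norm (ltW t0)).
- by apply: le_trans (Re_le_cabs _); rewrite /= (ger0_norm (ltW t0)).
- by apply: le_trans (Im_le_cabs _); rewrite /= normrN (ger0_norm (ltW t0)).
- by apply: le_trans (Im_le_cabs _); rewrite /= (ger0_norm (ltW t0)).
Qed.

(** The winding integral; its exact value is 2 pi i. *)
Lemma oint_inv_ge t : 0 < t ->
  4 <= cabs (oint (fun z : C => z^-1) (- t) t (- t) t).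
Proof.
move=> t0; pose phi (x : R) : R := t / (t ^+ 2 + x ^+ 2).
have den (x : R) : 0 < t ^+ 2 + x ^+ 2 by rewrite ltr_pwDl ?sqr_ge0// exprn_gt0.
have tt : - t <= t by lra.
have phic : rcont phi (- t) t.
  move=> x _; apply: cvgM; first exact: cvg_cst.
  apply: cvgV; first by rewrite gt_eqF.
  by apply: cvgD; [exact: cvg_cst|apply: cvgM; exact: cvg_id].
have phi1 : 1 <= rint phi (- t) t.
  have := @rint_ge _ phi (- t) t ((2 * t)^-1) tt phic.
  have -> : (2 * t)^-1 * (t - - t) = 1 by field; rewrite gt_eqF.
  apply=> x /andP[x1 x2]; rewrite /phi.
  rewrite ler_pdivlMr// mulrC ler_pdivrMr ?mulr_gt0//.
  by nra.
apply: le_trans (Im_le_cabs _); apply: le_trans (ler_norm _).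
rewrite /oint /= !(mul0r, mul1r, subr0, add0r, oppr0, addr0).
have e1 : rint (fun x => complex.Im (Complex x (- t))^-1) (- t) t = rint phi (- t) t.
  by congr rint; apply/funext => x; rewrite /= /phi sqrrN mulNr opprK addrC.
have e2 : rint (fun x => complex.Im (Complex x t)^-1) (- t) t = - rint phi (- t) t.
  rewrite -[RHS]mulN1r -rintZ//.
  by congr rint; apply/funext => x; rewrite /= /phi addrC mulN1r.
have e3 : rint (fun y => complex.Re (Complex t y)^-1) (- t) t = rint phi (- t) t.
  by congr rint.
have e4 : rint (fun y => complex.Re (Complex (- t) y)^-1) (- t) t = - rint phi (- t) t.
  rewrite -[RHS]mulN1r -rintZ//.
  by congr rint; apply/funext => x; rewrite /= /phi sqrrN mulN1r mulNr.
rewrite [X in _ <= X + _ + _]e1 [X in _ <= _ - X + _]e2 [X in _ <= _ + (X + _)]e3.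
rewrite [X in _ <= _ + (_ - X)]e4; lra.
Qed.

(** The integral of h is the same over all squares centred at the
    singularity, as the rest of a larger square splits into four rectangles
    covered by Goursat. *)
Lemma oint_deformation h (u t : R) : 0 < u -> u <= t ->
  on_rect (- t) t (- t) t (fun z => z != 0 -> exists k, cdiff h z k) ->
  oint h (- t) t (- t) t = oint h (- u) u (- u) u.
Proof.
move=> u0 ut hd.
have tu : - t <= - u by rewrite lerN2.
have uu : - u <= u by lra.
have tt : - t <= t by lra.
have nz1 x y : x != 0 -> Complex x y != 0 :> C by move=> x0; rewrite eq_complex /= negb_and x0.
have nz2 x y : y != 0 -> Complex x y != 0 :> C by move=> y0; rewrite eq_complex /= negb_and y0 orbT.
have hor a b c d : - t <= a -> b <= t -> - t <= c -> d <= t ->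
  (forall y, c <= y <= d -> y != 0) \/ (forall x, a <= x <= b -> x != 0) ->
  on_rect a b c d (fun z => exists k, cdiff h z k).
  move=> ta bt tc dt hy x y xI yI; apply: hd.
  - by case/andP: xI => ? ?; lra.
  - by case/andP: yI => ? ?; lra.
  - by case: hy => [/(_ _ yI)/nz2|/(_ _ xI)/nz1].
have fr x y : (x = - t \/ x = t \/ x = - u \/ x = u) \/
    (y = - t \/ y = t \/ y = - u \/ y = u) -> Complex x y != 0 :> C.
  have u0' : u != 0 by rewrite gt_eqF.
  have t0' : t != 0 by rewrite gt_eqF// (lt_le_trans u0).
  by case=> [|] [->|[->|[->|->]]]; [apply: nz1|apply: nz1|apply: nz1|apply: nz1|
    apply: nz2|apply: nz2|apply: nz2|apply: nz2];
    rewrite ?oppr_eq0.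
have edge a b c d : - t <= a -> b <= t -> - t <= c -> d <= t ->
    (forall x y, [\/ x = a, x = b, y = c | y = d] -> Complex x y != 0 :> C) ->
    on_frame a b c d (cont_at h).
  move=> ta bt tc dt nz x y /andP[ax xb] /andP[cy yd] /nz xy0.
  have [] // := hd x y _ _ xy0; [lra|lra|by move=> k /cdiff_continuous].
have tu' : - t <= u by lra.
have ut' : - u <= t by lra.
rewrite (@oint_splitx _ h (- t) (- u) t (- t) t)//; last first.
  by apply: edge => // x y [] ->; apply: fr; tauto.
rewrite (@oint_splitx _ h (- u) u t (- t) t)//; last first.
  by apply: edge => // x y [] ->; apply: fr; tauto.
rewrite (@oint_splity _ h (- u) u (- t) (- u) t)//; last first.
  by apply: edge => // x y [] ->; apply: fr; tauto.
rewrite (@oint_splity _ h (- u) u (- u) u t)//; last first.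
  by apply: edge => // x y [] ->; apply: fr; tauto.
rewrite (@goursat _ h (- t) (- u) (- t) t)//; last first.
  by apply: hor => //; right => x; lra.
rewrite (@goursat _ h u t (- t) t)//; last first.
  by apply: hor => //; right => x; lra.
rewrite (@goursat _ h (- u) u (- t) (- u))//; last first.
  by apply: hor => //; left => x; lra.
rewrite (@goursat _ h (- u) u u t)//; last first.
  by apply: hor => //; left => x; lra.
by rewrite !(add0r, addr0).
Qed.

End WindingAndDeformation.

(** * Cauchy's estimate for the derivative *)

Section CauchyEstimate.
Variable R : realType.
Local Notation C := (Cplx R).
Local Notation "x %:C" := (real_complex R x).
Implicit Types (f g h : C -> C) (a b c d t x y : R) (k z w : C).

Let dM f g z : derivable f z 1 -> derivable g z 1 ->
  derivable (fun w : C => f w * g w : C) z 1.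
Proof. exact: (@derivableM C C f g z 1). Qed.

Let dB f g z : derivable f z 1 -> derivable g z 1 ->
  derivable (fun w : C => f w - g w : C) z 1.
Proof. exact: (@derivableB C C C f g z 1). Qed.

Let dcst k z : derivable (fun _ : C => k) z 1.
Proof. exact: (@derivable_cst C C C k z 1). Qed.

(** Cauchy's formula for the first derivative at the centre of a square: the kernel
    minus its polar part k / z is o(1 / z), so its integral over small squares
    tends to 0. *)
Lemma cauchy_estimate g k t (M : R) : 0 < t ->
  on_rect (- t) t (- t) t (fun z => exists k, cdiff g z k) -> cdiff g 0 k ->
  on_frame (- t) t (- t) t (fun z => cabs (g z - g 0) <= M) ->
  cabs k <= 4 * M / t.
Proof.
move=> t0 gd gk gM; have tt : - t <= t by lra.
pose A (z : C) : C := (g z - g 0) * (z^-1 * z^-1); pose B (z : C) : C := z^-1.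
pose h (z : C) : C := A z - k * B z.
have Bd z : z != 0 -> derivable B z 1.
  by move=> z0; apply: derivableV => //; exact: derivable_id.
have Ad z : z != 0 -> (exists l, cdiff g z l) -> derivable A z 1.
  move=> z0 [l /cdiff_derivable gz].
  exact: (dM (dB gz (@dcst (g 0) z)) (dM (Bd z z0) (Bd z z0))).
have hd z : z != 0 -> (exists l, cdiff g z l) -> exists l, cdiff h z l.
  move=> z0 gz; exists (derive1 h z); apply: derivable_cdiff.
  exact: (dB (Ad z z0 gz) (dM (@dcst k z) (Bd z z0))).
have hr u : 0 < u -> u <= t ->
    on_rect (- u) u (- u) u (fun z => z != 0 -> exists l, cdiff h z l).
  move=> u0 ut x y /andP[x1 x2] /andP[y1 y2] z0; apply: hd => //; apply: gd; lra.
have fr0 u x y : 0 < u -> [\/ x = - u, x = u, y = - u | y = u] -> Complex x y != 0 :> C.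
  move=> u0 /(frame_ge u0); apply: contraTneq => ->.
  by rewrite -ltNge cabs0.
have cont u f : 0 < u -> u <= t ->
    (forall z, z != 0 -> (exists l, cdiff g z l) -> derivable f z 1) ->
    on_frame (- u) u (- u) u (cont_at f).
  move=> u0 ut fd x y /andP[x1 x2] /andP[y1 y2] /(fr0 _ _ _ u0) z0.
  apply/differentiable_continuous/derivable1_diffP; apply: fd => //; apply: gd; lra.
have hc u : 0 < u -> u <= t -> on_frame (- u) u (- u) u (cont_at h).
  move=> u0 ut; apply: (cont u h u0 ut) => z z0 gz.
  exact: (dB (Ad z z0 gz) (dM (@dcst k z) (Bd z z0))).
have small e : 0 < e -> cabs (oint h (- t) t (- t) t) <= 16 * e.
  move=> e0; have [r r0 rP] := gk e e0.
  pose u := Num.min t (r / 4); have u0 : 0 < u by rewrite lt_min t0 divr_gt0.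
  have ut : u <= t by rewrite ge_min lexx.
  have ur : u <= r / 4 by rewrite ge_min lexx orbT.
  have uu : - u <= u by lra.
  rewrite (oint_deformation u0 ut (hr t t0 (lexx _))).
  have hM : on_frame (- u) u (- u) u (fun z => cabs (h z) <= e / u).
    move=> x y /andP[x1 x2] /andP[y1 y2] xy; have zu := frame_ge u0 xy.
    have z0 := fr0 _ _ _ u0 xy; move: zu z0; set z : C := Complex x y => zu z0.
    have zr : cabs (z - 0) < r.
      rewrite subr0; apply: le_lt_trans (cabs_le_ReIm _) _ => /=.
      have : `|x| <= u by rewrite ler_norml x1.
      have : `|y| <= u by rewrite ler_norml y1.
      lra.
    have := rP _ zr; rewrite subr0 => hz.
    have -> : h z = (g z - g 0 - k * z) * (z^-1 * z^-1) by rewrite /h /A /B; field.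
    have zp := cabs_gt0 z0.
    rewrite !cabsM cabsV ler_pdivlMr//.
    have h1 : cabs (g z - g 0 - k * z) * ((cabs z)^-1 * (cabs z)^-1) <= e / cabs z.
      apply: le_trans (ler_wpM2r _ hz) _; first by rewrite mulr_ge0 ?invr_ge0 ?cabs_ge0.
      by rewrite -mulrA (mulrA (cabs z)) mulfV ?gt_eqF// mul1r.
    apply: le_trans (ler_wpM2r (ltW u0) h1) _.
    by rewrite mulrAC ler_pdivrMr// ler_wpM2l// ltW.
  have := oint_bound uu uu (hc u u0 ut) hM.
  have -> : 4 * (e / u) * (u - - u + (u - - u)) = 16 * e by field; rewrite gt_eqF.
  by [].
have h0 : oint h (- t) t (- t) t = 0.
  apply: contrapT => /eqP/cabs_gt0 o0.
  (* any divisor above the constant 16 of [small] will do *)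
  by have := small _ (divr_gt0 o0 (ltr0n _ 17)); lra.
have Ac := cont t A t0 (lexx _) Ad.
have Bc := cont t B t0 (lexx _) (fun z nz _ => Bd z nz).
have kBc : on_frame (- t) t (- t) t (cont_at (fun z => k * B z)).
  apply: (cont t _ t0 (lexx _)) => z z0 _.
  exact: (dM (@dcst k z) (Bd z z0)).
have kB : oint A (- t) t (- t) t = k * oint B (- t) t (- t) t.
  apply/eqP; rewrite -subr_eq0; apply/eqP.
  by rewrite -(ointZ k tt tt Bc) -(ointB tt tt Ac kBc).
have AM : on_frame (- t) t (- t) t (fun z => cabs (A z) <= M / t ^+ 2).
  move=> x y xI yI xy; have zt := frame_ge t0 xy; have zM := gM x y xI yI xy.
  have M0 : 0 <= M by apply: le_trans zM; exact: cabs_ge0.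
  rewrite /A !cabsM cabsV; apply: ler_pM => //.
  - exact: cabs_ge0.
  - by rewrite mulr_ge0 ?invr_ge0 ?cabs_ge0.
  have h1 : (cabs (Complex x y : C))^-1 <= t^-1 by rewrite lef_pV2// posrE (lt_le_trans t0).
  by rewrite expr2 invfM ler_pM ?invr_ge0 ?cabs_ge0.
have := oint_bound tt tt Ac AM; rewrite kB cabsM.
have -> : 4 * (M / t ^+ 2) * (t - - t + (t - - t)) = 16 * M / t by field; rewrite gt_eqF.
have := oint_inv_ge t0; have := cabs_ge0 k; rewrite -/B.
set K := cabs k; set W := cabs _.
have -> : 16 * M / t = 4 * (4 * M / t) by ring.
nra.
Qed.

(** Applied to the difference of two translates of f: where the derivative is
    bounded, it is also Lipschitz. *)
Lemma deriv_lipschitz f (df : C -> C) z (d S : R) : 0 < d ->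
  (forall w, cabs (w - z) < d -> cdiff f w (df w)) ->
  (forall w, cabs (w - z) < d -> cabs (df w) <= S) ->
  forall w, cabs (w - z) <= d / 2 ->
    cabs (df w - df z) <= 64 * S / d * cabs (w - z).
Proof.
(* points of the square of half-side d / 8 are at distance at most d / 4 from its
   centre, so its translate by any point of the half-disc stays in the disc *)
move=> d0 fd dS w wz; pose t := d / 8; have t0 : 0 < t by rewrite divr_gt0.
have z0 : cabs (z - z) < d by rewrite subrr cabs0.
have S0 : 0 <= S by apply: le_trans (dS _ z0); exact: cabs_ge0.
have near_w u : cabs u <= d / 4 -> forall s, 0 <= s <= 1 ->
    cabs (z + u + s%:C * (w - z) - z) < d.
  move=> ud s /andP[s0 s1].
  have -> : z + u + s%:C * (w - z) - z = u + s%:C * (w - z) by ring.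
  apply: le_lt_trans (cabsD _ _) _; rewrite cabsM cabs_real ger0_norm//.
  have := cabs_ge0 (w - z); nra.
have rect_small x y : - t <= x <= t -> - t <= y <= t -> cabs (Complex x y : C) <= d / 4.
  move=> xI yI; apply: le_trans (cabs_le_ReIm _) _ => /=.
  move: xI yI; rewrite -!ler_norml /t; lra.
pose g u := f (w + u) - f (z + u).
have gd u : cabs u <= d / 4 -> cdiff g u (df (w + u) - df (z + u)).
  move=> ud; apply: cdiffB; apply: cdiff_shift; apply: fd.
    have := near_w u ud 1; rewrite ler01 lexx => /(_ isT).
    by rewrite rmorph1 mul1r (_ : z + u + (w - z) = w + u)//; ring.
  have := near_w u ud 0; rewrite ler01 lexx => /(_ isT).
  by rewrite rmorph0 mul0r addr0.
have gb u : cabs u <= d / 4 -> cabs (g u) <= S * cabs (w - z).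
  move=> ud; have E : (w + u) - (z + u) = w - z by ring.
  rewrite /g -E; apply: (@cmean_value_Lip _ f (fun s => df (z + u + s%:C * (w - z)))).
    by move=> s sI; rewrite E; apply: fd; exact: near_w.
  by move=> s sI; apply: dS; exact: near_w.
have := @cauchy_estimate g (df (w + 0) - df (z + 0)) t (2 * (S * cabs (w - z))) t0.
have d40 : cabs (0 : C) <= d / 4 by rewrite cabs0 divr_ge0// ltW.
have -> : 4 * (2 * (S * cabs (w - z))) / t = 64 * S / d * cabs (w - z).
  by rewrite /t; field; rewrite gt_eqF.
rewrite !addr0; apply.
- by move=> x y xI yI; eexists; apply: gd; exact: rect_small.
- by have := gd 0 d40; rewrite !addr0.
- move=> x y xI yI _; apply: le_trans (cabsB _ _) _.
  have := gb _ d40; have := gb _ (rect_small _ _ xI yI); lra.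
Qed.

Lemma continuous_rect_bounded f a b c d : a <= b -> c <= d ->
  on_rect a b c d (cont_at f) ->
  exists M : R, on_rect a b c d (fun z => cabs (f z) <= M).
Proof.
move=> ab cd fc.
apply: (@rect_cousin R (fun x1 x2 y1 y2 =>
  exists M : R, on_rect x1 x2 y1 y2 (fun z => cabs (f z) <= M)) a b c d) => //.
  move=> x1 x2 y1 y2 _ _ [M1 H1] [M2 H2] [M3 H3] [M4 H4].
  exists (Num.max (Num.max M1 M2) (Num.max M3 M4)) => x y /andP[xa xb] /andP[yc yd].
  rewrite !le_max -orbA; have [xm|xm] := leP x ((x1 + x2) / 2).
    have [ym|ym] := leP y ((y1 + y2) / 2).
      by rewrite H1 ?xa ?yc.
    by rewrite H3 ?xa ?(ltW ym) ?orbT.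
  have [ym|ym] := leP y ((y1 + y2) / 2).
    by rewrite H2 ?(ltW xm) ?yc ?orbT.
  by rewrite H4 ?(ltW xm) ?(ltW ym) ?orbT.
move=> x y xI yI; have /continuous_cabsP/(_ 1 ltr01)[r r0 rP] := fc x y xI yI.
exists (r / 2); first by rewrite divr_gt0.
move=> x1 x2 y1 y2 /andP[x1x xx2] /andP[y1y yy2] _ _ _ _ sx sy.
exists (1 + cabs (f (Complex x y))) => u v /andP[x1u ux2] /andP[y1v vy2].
have uv : cabs (Complex u v - Complex x y) < r.
  apply: le_lt_trans (cabs_le_ReIm _) _ => /=; rewrite [ltRHS]splitr; apply: ltrD.
    by rewrite ltr_norml; apply/andP; split; lra.
  by rewrite ltr_norml; apply/andP; split; lra.
have := cabsD (f (Complex u v) - f (Complex x y)) (f (Complex x y)); rewrite subrK.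
have := rP _ uv; lra.
Qed.

(** The factor 4 leaves room for a square between the discs of radii 2 r and
    4 r: f is bounded on that square, and Cauchy's estimate on squares about the
    points of the disc of radius r gives the bound on the derivative. *)
Lemma deriv_locally_bounded f (df : C -> C) z (r : R) : 0 < r ->
  (forall w, cabs (w - z) < 4 * r -> cdiff f w (df w)) ->
  exists N : R, forall w, cabs (w - z) < r -> cabs (df w) <= N.
Proof.
move=> r0 fd; case: z fd => x0 y0 fd.
have [M HM] : exists M : R,
    on_rect (x0 - 2 * r) (x0 + 2 * r) (y0 - 2 * r) (y0 + 2 * r) (fun z => cabs (f z) <= M).
  apply: continuous_rect_bounded; [lra|lra|] => x y /andP[x1 x2] /andP[y1 y2].
  apply: (cdiff_continuous (fd _ _)).
  have rr : 0 <= 8 * r ^+ 2 by have := sqr_ge0 r; lra.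
  have -> : 4 * r = Num.sqrt ((4 * r) ^+ 2) by rewrite sqrtr_sqr ger0_norm; lra.
  rewrite /= ltr_sqrt; last by rewrite exprn_gt0// mulr_gt0.
  have r20 : 0 < r * r by rewrite mulr_gt0.
  rewrite !expr2; nra.
have M2 w : cabs (w - Complex x0 y0) <= 2 * r -> cabs (f w) <= M.
  case: w => u v uv; apply: HM.
    have := le_trans (Re_le_cabs _) uv; rewrite /= ler_norml => /andP[? ?].
    by apply/andP; split; lra.
  have := le_trans (Im_le_cabs _) uv; rewrite /= ler_norml => /andP[? ?].
  by apply/andP; split; lra.
exists (16 * M / r) => w wz; pose t := r / 2; have t0 : 0 < t by rewrite divr_gt0.
have rect_small x y : - t <= x <= t -> - t <= y <= t ->
    cabs (w + Complex x y - Complex x0 y0) <= 2 * r.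
  move=> xI yI; rewrite addrAC; apply: le_trans (cabsD _ _) _.
  have : cabs (Complex x y : C) <= r.
    apply: le_trans (cabs_le_ReIm _) _ => /=.
    by move: xI yI; rewrite -!ler_norml /t; lra.
  lra.
have := @cauchy_estimate (fun u => f (w + u)) (df w) t (2 * M) t0.
have -> : 4 * (2 * M) / t = 16 * M / r by rewrite /t; field; rewrite gt_eqF.
apply.
- move=> x y xI yI; eexists; apply: cdiff_shift; apply: fd.
  by apply: le_lt_trans (rect_small _ _ xI yI) _; lra.
- by apply: cdiff_shift; rewrite addr0; apply: fd; lra.
- move=> x y xI yI _; apply: le_trans (cabsB _ _) _; rewrite addr0.
  have := M2 _ (rect_small _ _ xI yI).
  have : cabs (f w) <= M by apply: M2; lra.
  lra.
Qed.

End CauchyEstimate.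

(** * Lower bounds for area integrals *)

Section AreaIntegral.
Variable R : realType.
Local Notation C := (Cplx R).
Import HBNNSimple.

(** [area] is given as a set function and not as a measure; the integrals against it
    are bounded from below with the sole property that it vanishes on the empty
    set. *)
Section SetFunctionIntegral.
Context d (T : measurableType d) (m : set T -> \bar R).
Hypothesis m0 : m set0 = 0%E.

Lemma sintegral_zero (h : T -> R) : (forall z, h z = 0) -> sintegral m h = 0%E.
Proof.
move=> h0; apply: fsbig1 => v _; have [->|v0] := eqVneq v 0; first by rewrite mul0e.
rewrite (_ : h @^-1` [set v] = set0) ?m0 ?mule0//.
by apply/seteqP; split=> // z /=; rewrite h0 => /esym/eqP; rewrite (negPf v0).
Qed.

Lemma ereal_sup_sintegral_zero :
  ereal_sup [set sintegral m h | h in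
    [set h : {nnsfun T >-> R} | forall x, ((h x)%:E <= cst 0 x)%E]] = 0%E.
Proof.
rewrite (_ : [set _ | _ in _] = [set 0%E]) ?ereal_sup1//.
apply/seteqP; split=> [_ [h h0 <-]|_ ->] /=.
  apply: sintegral_zero => z; apply/eqP; rewrite eq_le fun_ge0 andbT.
  by have := h0 z; rewrite lee_fin.
by exists nnsfun0 => //; apply: sintegral_zero.
Qed.

Lemma ge0_set_function_integralE (D : set T) (f : T -> \bar R) :
  (forall z, D z -> 0%E <= f z)%E ->
  (\int[m]_(z in D) f z)%E = ereal_sup [set sintegral m h | h in
    [set h : {nnsfun T >-> R} | forall x, ((h x)%:E <= (f \_ D) x)%E]].
Proof.
move=> f0; rewrite /integral funeneg_restrict funepos_restrict.
have /eq_restrictP-> := ge0_funeposE f0.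
have /eq_restrictP-> := ge0_funenegE f0.
by rewrite erestrict0 ereal_sup_sintegral_zero sube0.
Qed.

Lemma set_function_integral_zero (D : set T) : (\int[m]_(z in D) 0 = 0)%E.
Proof.
by rewrite ge0_set_function_integralE// erestrict0 ereal_sup_sintegral_zero.
Qed.

Lemma set_function_integral_ge0 (D : set T) (f : T -> \bar R) :
  (forall z, D z -> 0%E <= f z)%E -> (0 <= \int[m]_(z in D) f z)%E.
Proof.
move=> f0; rewrite ge0_set_function_integralE//; apply: ereal_sup_ubound.
exists nnsfun0; last by apply: sintegral_zero.
by move=> z /=; rewrite /patch; case: ifPn => // /set_mem; exact: f0.
Qed.

(** It suffices to exhibit the simple function equal to x on Q and to 0 elsewhere. *)
Lemma integral_ge_indic (D Q : set T) (f : T -> \bar R) (x : R) :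
  measurable Q -> Q `<=` D -> (forall z, D z -> 0%E <= f z)%E -> 0 < x ->
  (forall z, Q z -> x%:E <= f z)%E ->
  (x%:E * m Q <= \int[m]_(z in D) f z)%E.
Proof.
move=> mQ QD f0 x0 xf; rewrite ge0_set_function_integralE//; apply: ereal_sup_ubound.
pose h := scale_nnsfun (indic_nnsfun R mQ) (ltW x0).
have hE z : h z = if z \in Q then x else 0.
  rewrite -[LHS]/(x * \1_Q z) indicE.
  by case: (z \in Q); rewrite ?mulr1 ?mulr0.
have preE v z : (h @^-1` [set v]) z <-> (if z \in Q then x else 0) = v.
  by rewrite -hE.
exists h.
  move=> z; change ((h z)%:E <= (f \_ D) z)%E; rewrite hE /patch.
  case: ifPn => zQ; first by rewrite mem_set; [exact/xf/set_mem|exact/QD/set_mem].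
  by case: ifPn => // /set_mem; exact: f0.
rewrite /sintegral -(@fsbig_widen _ _ _ _ [set x])//.
  rewrite fsbig_set1; congr (_ * m _)%E.
  apply/seteqP; split=> z; first move=> /preE.
    by case: ifPn => [/set_mem//|_ /esym/eqP]; rewrite gt_eqF.
  by move=> zQ; apply/preE; rewrite mem_set.
move=> v [_ vx]; change ((v%:E * m (h @^-1` [set v]))%E = 0%E).
have [->|v0] := eqVneq v 0; first by rewrite mul0e.
rewrite (_ : h @^-1` [set v] = set0) ?m0 ?mule0//.
apply/seteqP; split=> // z /preE.
by case: ifPn => _ => [/esym//|/esym/eqP]; rewrite (negPf v0).
Qed.

End SetFunctionIntegral.

Definition osquare (z0 : C) (e : R) : set C :=
  [set z | `|complex.Re z - complex.Re z0| < e /\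
           `|complex.Im z - complex.Im z0| < e].

Lemma open_osquare z0 e : open (osquare z0 e).
Proof.
rewrite openE => z [zr zi]; apply/nbhs_cabs.
exists (Num.min (e - `|complex.Re z - complex.Re z0|) (e - `|complex.Im z - complex.Im z0|)).
  by rewrite lt_min !subr_gt0 zr.
move=> w; rewrite lt_min !ltrBrDr => /andP[wr wi]; split.
  have := ler_distD (complex.Re z) (complex.Re w) (complex.Re z0).
  have := Re_le_cabs (w - z); rewrite (_ : complex.Re (w - z) = complex.Re w - complex.Re z).
    by move=> h1 h2; apply: le_lt_trans h2 _; lra.
  by case: (w) (z) => ? ? [? ?].
have := ler_distD (complex.Im z) (complex.Im w) (complex.Im z0).
have := Im_le_cabs (w - z); rewrite (_ : complex.Im (w - z) = complex.Im w - complex.Im z).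
  by move=> h1 h2; apply: le_lt_trans h2 _; lra.
by case: (w) (z) => ? ? [? ?].
Qed.

Lemma measurable_openC (A : set C) : open A -> measurable (A : set (BorelC R)).
Proof. by move=> oA; exact: sub_sigma_algebra. Qed.

Lemma area_set0 : @area R set0 = 0%E.
Proof.
rewrite /area (_ : [set w | _] = set0) ?measure0 ?mule0//.
Qed.

Lemma area_osquare z0 e : 0 < e ->
  @area R (osquare z0 e) = (pi^-1 * (2 * e) ^+ 2)%:E.
Proof.
move=> e0; rewrite /area.
pose I (c : R) := `]c - e, c + e[%classic.
rewrite (_ : [set w | _] = I (complex.Re z0) `*` I (complex.Im z0)).
  have mI c : (@lebesgue_measure R (I c) = (2 * e)%:E)%E.
    rewrite /I lebesgue_measure_itv/= lte_fin ltrD2l gtrN// -EFinD.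
    by congr EFin; ring.
  rewrite product_measure1E; [|exact: measurable_itv|exact: measurable_itv].
  by rewrite [X in (_ * (X * _))%E]mI [X in (_ * (_ * X))%E]mI -!EFinM expr2.
apply/seteqP; split=> -[x y] /=; rewrite /osquare /I /= !in_itv/= !ltr_distl.
  by move=> [-> ->].
by move=> [-> ->].
Qed.

Lemma area_integral_ge (D : set C) (f : C -> \bar R) z0 (e x : R) : 0 < e -> 0 < x ->
  osquare z0 e `<=` D -> (forall z, D z -> 0%E <= f z)%E ->
  (forall z, osquare z0 e z -> x%:E <= f z)%E ->
  ((x * (pi^-1 * (2 * e) ^+ 2))%:E <= \int[@area R]_(z in (D : set (BorelC R))) f z)%E.
Proof.
move=> e0 x0 QD f0 xf; rewrite EFinM -(area_osquare z0)//.
have mQ := measurable_openC (@open_osquare z0 e).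
exact: (@integral_ge_indic _ (BorelC R) (@area R) area_set0 D _ f x mQ QD f0 x0 xf).
Qed.

End AreaIntegral.

(** * Growth of the derivative in F(p, p alpha - 2, s) *)

Section GrowthOfDerivative.
Variable R : realType.
Local Notation C := (Cplx R).
Implicit Types (z w a : C).

(** Moving from a to a point where the weighted function (r - |z - a|)^k g(z)
    is almost maximal, g is controlled on a whole disc by its value at the
    centre. *)
Lemma point_picking (g : C -> R) a (r k N : R) : 0 < r -> 0 < k ->
  (forall w, 0 <= g w) -> 0 < g a -> (forall w, cabs (w - a) < r -> g w <= N) ->
  exists2 z, cabs (z - a) < r &
    r `^ k * g a <= 2 * ((r - cabs (z - a)) `^ k * g z) /\
    forall w, cabs (w - z) <= (r - cabs (z - a)) / 2 -> g w <= 2 * 2 `^ k * g z.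
Proof.
move=> r0 k0 g0 ga gN.
have mono (x y : R) : 0 <= x -> x <= y -> x `^ k <= y `^ k.
  by move=> x0 xy; apply: ge0_ler_powR; rewrite ?nnegrE ?(ltW k0)// (le_trans x0).
pose wt z := (r - cabs (z - a)) `^ k * g z.
pose E := [set wt z | z in [set z | cabs (z - a) < r]].
have aE : E (r `^ k * g a).
  by exists a; rewrite /= /wt subrr cabs0 ?subr0.
have Eub : ubound E (r `^ k * N).
  move=> _ [z /= zr <-]; apply: ler_pM => //; first exact: powR_ge0.
    by apply: mono; have := cabs_ge0 (z - a); lra.
  exact: gN.
have Esup : has_sup E by split; [exists (r `^ k * g a)|exists (r `^ k * N)].
have asup : r `^ k * g a <= sup E by apply: ub_le_sup => //; exists (r `^ k * N).
have s0 : 0 < sup E by apply: lt_le_trans asup; rewrite mulr_gt0// powR_gt0.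
have [_ [z /= zr <-] zs] := sup_adherent (divr_gt0 s0 (ltr0n _ 2)) Esup.
have {}zs : sup E < 2 * wt z by lra.
exists z => //; split; first by apply: le_trans asup _; exact: ltW.
set rho := r - cabs (z - a) => w wz.
have rho0 : 0 < rho by rewrite subr_gt0.
have wa : cabs (w - a) <= r - rho / 2.
  by have := cabs_tri z w a; rewrite /rho in wz *; lra.
have : wt w <= sup E.
  apply: ub_le_sup; first by exists (r `^ k * N).
  by exists w => //=; lra.
have : (rho / 2) `^ k * g w <= wt w.
  by apply: ler_wpM2r => //; apply: mono; lra.
move=> h1 h2; have {h1 h2} h : (rho / 2) `^ k * g w <= 2 * wt z by lra.
have p0 : 0 < (rho / 2) `^ k by rewrite powR_gt0// divr_gt0.
rewrite -(ler_pM2l p0); apply: le_trans h _; rewrite /wt -/rho.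
have {1}-> : rho = (rho / 2) * 2 by lra.
rewrite powRM//; last by rewrite divr_ge0// ltW.
by rewrite le_eqVlt; apply/orP; left; apply/eqP; ring.
Qed.

Lemma powR_ge_min (q u v y : R) : 0 < u -> u <= y -> y <= v ->
  Num.min (u `^ q) (v `^ q) <= y `^ q.
Proof.
move=> u0 uy yv; have y0 := lt_le_trans u0 uy; have v0 := lt_le_trans y0 yv.
have [q0|q0] := leP 0 q.
  rewrite ge_min; apply/orP; left.
  by apply: ge0_ler_powR; rewrite // nnegrE ltW.
rewrite ge_min; apply/orP; right.
rewrite -[q]opprK !(powRN _ (- q)) lef_pV2 ?posrE ?powR_gt0//.
by apply: ge0_ler_powR; rewrite // ?oppr_ge0 ?nnegrE ltW.
Qed.

(** Since |1 - conj(a) w| >= 1 - |a|, the pseudo-hyperbolic distance from a to w is at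
    most 1/2. *)
Lemma moebius_weight a w : cabs a < 1 -> cabs (w - a) <= (1 - cabs a) / 2 ->
  3 / 4 <= 1 - cabs (moebius a w) ^+ 2.
Proof.
move=> a1 wa; set d := 1 - cabs a in wa; have d0 : 0 < d by rewrite subr_gt0.
have w1 : cabs w <= 1.
  by have := cabsD (w - a) a; rewrite subrK /d in wa *; lra.
have ca : cabs (conjc a) = cabs a by case: (a) => x y /=; rewrite sqrrN.
have den : d <= cabs (1 - conjc a * w).
  have := cabsD (1 - conjc a * w) (conjc a * w); rewrite subrK cabs1 cabsM ca.
  have := cabs_ge0 a; rewrite /d; nra.
have : cabs (moebius a w) <= 1 / 2.
  rewrite /moebius cabsM cabsV cabsC ler_pdivrMr ?(lt_le_trans d0)//.
  lra.
have := cabs_ge0 (moebius a w); rewrite expr2; nra.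
Qed.

Lemma weight_lower_bound (q : R) : exists2 c : R, 0 < c & forall a w,
  cabs a < 1 -> cabs (w - a) <= (1 - cabs a) / 4 ->
  c * (1 - cabs a) `^ q <= (1 - cabs w ^+ 2) `^ q.
Proof.
exists (Num.min ((1 / 2) `^ q) (4 `^ q)).
  by rewrite lt_min; apply/andP; split; apply: powR_gt0; [rewrite divr_gt0|].
move=> a w a1 wa; set d := 1 - cabs a in wa *; have d0 : 0 < d by rewrite subr_gt0.
have d1 : d <= 1 by have := cabs_ge0 a; rewrite /d; lra.
have w0 := cabs_ge0 w.
have wl : cabs w <= 1 - 3 / 4 * d.
  by have := cabsD (w - a) a; rewrite subrK /d in wa *; lra.
have wg : 1 - 5 / 4 * d <= cabs w.
  by have := cabsB w (w - a); rewrite subKr /d in wa *; lra.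
have -> : 1 - cabs w ^+ 2 = ((1 - cabs w ^+ 2) / d) * d by rewrite mulfVK// gt_eqF.
have y1 : 1 / 2 <= (1 - cabs w ^+ 2) / d by rewrite ler_pdivlMr//; nra.
have y2 : (1 - cabs w ^+ 2) / d <= 4 by rewrite ler_pdivrMr//; nra.
rewrite [leRHS]powRM; [|lra|exact: ltW]; apply: ler_wpM2r; first exact: powR_ge0.
by apply: powR_ge_min => //; rewrite divr_gt0.
Qed.

(** The derivative is Lipschitz where it is at most K times its value at
    the centre, so it keeps half of that value on a square of comparable size. *)
Lemma deriv_large_on_square (f df : C -> C) z (d K : R) : 0 < d -> 1 <= K ->
  (forall w, cabs (w - z) < d -> cdiff f w (df w)) ->
  (forall w, cabs (w - z) < d -> cabs (df w) <= K * cabs (df z)) ->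
  forall w, osquare z (d / (256 * K)) w ->
    cabs (w - z) <= d / 2 /\ cabs (df z) / 2 <= cabs (df w).
Proof.
(* by [deriv_lipschitz] the derivative varies by at most 64 K |df z| / d times the
   distance 2 eta, which is |df z| / 2 for this choice of eta *)
move=> d0 K1 fd dfK w [wr wi]; set eta := d / _ in wr wi.
have K0 : 0 < K by lra.
have wz : cabs (w - z) <= 2 * eta.
  apply: le_trans (cabs_le_ReIm _) _.
  have -> : complex.Re (w - z) = complex.Re w - complex.Re z by case: (w) (z) => ? ? [? ?].
  have -> : complex.Im (w - z) = complex.Im w - complex.Im z by case: (w) (z) => ? ? [? ?].
  by rewrite mulr_natl mulr2n lerD// ltW.
have KV : K^-1 <= 1 by rewrite invf_le1.
have etaE : eta = d / 256 * K^-1 by rewrite /eta invfM mulrA.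
have KV0 : 0 < K^-1 by rewrite invr_gt0.
have eta_small : 2 * eta <= d / 2.
  by rewrite etaE; clear -d0 KV KV0; nra.
have wd : cabs (w - z) <= d / 2 by exact: le_trans wz eta_small.
split=> //.
have lip := deriv_lipschitz d0 fd dfK wd.
have z0 := cabs_ge0 (df z).
have h1 : 64 * (K * cabs (df z)) / d * cabs (w - z) <= cabs (df z) / 2.
  have -> : cabs (df z) / 2 = 64 * (K * cabs (df z)) / d * (2 * eta).
    by rewrite /eta; field; rewrite !gt_eqF.
  apply: ler_wpM2l => //; rewrite divr_ge0 ?(ltW d0)//.
  by apply: mulr_ge0 => //; apply: mulr_ge0 => //; exact: ltW.
have := cabsB (df w) (df w - df z); rewrite subKr.
clear -h1 lip; lra.
Qed.


(** The arithmetic of the growth estimate: t stands for p alpha, G for |f'(z)|, and the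
    last two hypotheses are those delivered by point picking and by the
    integral over the square. *)
Lemma powR_comparison (p q t L K r rho eta G d ga M w pv : R) : 0 < p -> 0 < t ->
  0 < w -> 0 < pv -> 0 < L -> 0 < K -> 0 < d -> 0 < rho ->  0 <= M ->
  0 < ga -> 0 < G ->
  q + 2 = t ->
  rho = 2 * L * K * eta -> r = d / 4 ->
  r `^ (2 / p) * ga <= 2 * (rho `^ (2 / p) * G) ->
  (G / 2) `^ p * (w * d `^ q) * (pv^-1 * (2 * eta) ^+ 2) <= M ->
  ga <= (4 * 4 `^ p * (2 * L * K) ^+ 2 * pv / w) `^ p^-1 * M `^ p^-1 * d `^ (- (t / p)).
Proof.
move=> p0 t0 w0 pv0 L0 K0 d0 rho0 M0 ga0 G0 qt rhoE rE pick int.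
have r0 : 0 < r by rewrite rE divr_gt0.
have ge0R (x : R) : 0 < x -> 0 <= x by exact: ltW.
have powk (x : R) : 0 < x -> (x `^ (2 / p)) `^ p = x ^+ 2.
  by move=> x0; rewrite -powRrM mulfVK ?gt_eqF// powR_mulrn// ltW.
have gp : r ^+ 2 * ga `^ p <= 2 `^ p * (rho ^+ 2 * G `^ p).
  have h1 : 0 <= r `^ (2 / p) * ga by apply: mulr_ge0; [exact: powR_ge0|exact: ltW].
  have h2 : 0 <= rho `^ (2 / p) * G by apply: mulr_ge0; [exact: powR_ge0|exact: ltW].
  have h3 : 0 <= 2 * (rho `^ (2 / p) * G) by exact: mulr_ge0.
  have := @ge0_ler_powR R p (ltW p0) _ _ h1 h3 pick.
  rewrite (powRM _ (powR_ge0 _ _) (ltW ga0)) (powRM _ (ler0n _ 2) h2).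
  by rewrite (powRM _ (powR_ge0 _ _) (ltW G0)) !powk.
set Y := (G / 2) `^ p in int.
have GY : G `^ p = 2 `^ p * Y.
  rewrite /Y -powRM//; first by congr (_ `^ _); field.
  exact: (divr_ge0 (ltW G0) (ler0n _ 2)).
have four : 4 `^ p = 2 `^ p * 2 `^ p :> R.
  by rewrite -powRM//; congr (_ `^ _); ring.
have dq0 : 0 < d `^ q by exact: powR_gt0.
have dt : d `^ t = d ^+ 2 * d `^ q.
  rewrite -powR_mulrn ?(ltW d0)// -powRD; last by apply/implyP => _; rewrite gt_eqF.
  by rewrite -qt addrC.
set B := 4 * 4 `^ p * (2 * L * K) ^+ 2 * pv / w.
have B0 : 0 <= B.
  rewrite /B; apply: divr_ge0; last exact: ltW.
  apply: mulr_ge0; last exact: ltW.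
  by apply: mulr_ge0; [apply: mulr_ge0 => //; exact: powR_ge0|exact: sqr_ge0].
have gad : ga `^ p * d `^ t <= B * M.
  rewrite dt.
  have -> : ga `^ p * (d ^+ 2 * d `^ q) = 16 * (r ^+ 2 * ga `^ p) * d `^ q.
    by rewrite rE; field.
  apply: le_trans (_ : 16 * (2 `^ p * (rho ^+ 2 * G `^ p)) * d `^ q <= _).
    by apply: ler_wpM2r; [exact: ltW|rewrite ler_wpM2l].
  have -> : 16 * (2 `^ p * (rho ^+ 2 * G `^ p)) * d `^ q =
      B * (Y * (w * d `^ q) * (pv^-1 * (2 * eta) ^+ 2)).
    by rewrite /B GY four rhoE; field; rewrite !gt_eqF.
  exact: ler_wpM2l.
have {}gad : ga `^ p <= B * M * d `^ (- t).
  by rewrite powRN ler_pdivlMr// powR_gt0.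
have -> : ga = (ga `^ p) `^ p^-1 by rewrite -powRrM mulfV ?gt_eqF// powRr1// ltW.
have BM : 0 <= B * M by exact: mulr_ge0.
have h : 0 <= B * M * d `^ (- t) by apply: mulr_ge0 => //; exact: powR_ge0.
apply: le_trans (_ : (B * M * d `^ (- t)) `^ p^-1 <= _).
  apply: ge0_ler_powR => //; first by rewrite invr_ge0 ltW.
  by rewrite nnegrE powR_ge0.
by rewrite (powRM _ BM (powR_ge0 _ _)) (powRM _ B0 M0) -powRrM mulNr.
Qed.

(** On the disc given by point picking the derivative is at least half of its
    value at the centre on a comparable square, where the weights are of the order of
    (1 - |a|)^(p alpha - 2) and 1; the integral over this square alone gives the
    bound, for every p > 0. *)
Lemma F_deriv_bound (alpha s p : R) : 0 < alpha -> 0 < s -> 0 < p ->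
  exists2 c0 : R, 0 < c0 & forall (f : C -> C) (M : R), analytic f ->
    (F_seminorm_pow p (p * alpha - 2) s f <= M%:E)%E ->
    forall a : C, disk a ->
      cabs (derive1 f a) <= c0 * M `^ p^-1 * (1 - cabs a) `^ (- alpha).
Proof.
move=> al0 s0 p0; set q := p * alpha - 2; pose k := 2 / p.
have k0 : 0 < k by rewrite divr_gt0.
pose K : R := 2 * 2 `^ k.
have K1 : 1 <= K.
  have : 2 `^ 0 <= 2 `^ k :> R by apply: ler_powR; [lra|exact: ltW].
  by rewrite powRr0 /K; lra.
have K0 : 0 < K by exact: lt_le_trans K1.
have [cq cq0 cqP] := weight_lower_bound q.
pose cs : R := (3 / 4) `^ s.
have cs0 : 0 < cs by rewrite powR_gt0// divr_gt0.
exists ((4 * 4 `^ p * (2 * 256 * K) ^+ 2 * pi / (cq * cs)) `^ p^-1).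
  apply: powR_gt0; apply: divr_gt0; last exact: mulr_gt0.
  apply: mulr_gt0; last exact: pi_gt0.
  apply: mulr_gt0; first by apply: mulr_gt0; [|exact: powR_gt0].
  by apply: exprn_gt0; apply: mulr_gt0 K0; apply: mulr_gt0; rewrite ltr0n.
move=> f M fA fM a a1; pose g w := cabs (derive1 f w).
have [ga|ga] := leP (g a) 0.
  apply: le_trans ga _; apply: mulr_ge0; last exact: powR_ge0.
  by apply: mulr_ge0; exact: powR_ge0.
set d := 1 - cabs a; have d0 : 0 < d by rewrite subr_gt0.
pose r := d / 4; have r0 : 0 < r by rewrite divr_gt0.
have fd w : disk w -> cdiff f w (derive1 f w) by move=> /fA /derivable_cdiff.
have dr w : cabs (w - a) < 4 * r -> disk w.
  rewrite /disk/= => wa; have := cabsD (w - a) a; rewrite subrK.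
  by move: wa; rewrite /r /d; clear; lra.
have dr1 w : cabs (w - a) < r -> disk w.
  by move=> wa; apply: dr; clear - wa r0; lra.
have [N gN] : exists N : R, forall w, cabs (w - a) < r -> g w <= N.
  by apply: (deriv_locally_bounded r0) => w /dr; exact: fd.
have [z zr [gz gzS]] := point_picking r0 k0 (fun w => cabs_ge0 _) ga gN.
set rho := r - cabs (z - a) in gz gzS; have rho0 : 0 < rho by rewrite subr_gt0.
have gz0 : 0 < g z.
  have : 0 < 2 * (rho `^ k * g z) by apply: lt_le_trans gz; rewrite mulr_gt0// powR_gt0.
  by rewrite (pmulr_rgt0 _ (ltr0n _ 2)) (pmulr_rgt0 _ (powR_gt0 k rho0)).
have rho20 : 0 < rho / 2 by rewrite divr_gt0.
have zr2 w : cabs (w - z) <= rho / 2 -> cabs (w - a) < r.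
  by have := cabs_tri z w a; move: rho0; rewrite /rho; clear; lra.
pose eta := rho / 2 / (256 * K).
have eta0 : 0 < eta.
  by apply: (divr_gt0 rho20); apply: mulr_gt0 K0; rewrite ltr0n.
have Q w : osquare z eta w -> cabs (w - a) < r /\ g z / 2 <= g w.
  have Lf u : cabs (u - z) < rho / 2 -> cdiff f u (derive1 f u).
    by move=> /ltW /zr2 /dr1; exact: fd.
  have Lb u : cabs (u - z) < rho / 2 -> cabs (derive1 f u) <= K * cabs (derive1 f z).
    by move=> /ltW; exact: gzS.
  have L := @deriv_large_on_square f (derive1 f) z (rho / 2) K rho20 K1 Lf Lb w.
  by move=> /L[wz gw]; split => //; apply: zr2; apply: le_trans wz _; clear -rho0; lra.
pose X := (g z / 2) `^ p * (cq * d `^ q) * cs.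
have X0 : 0 < X.
  rewrite /X; apply: mulr_gt0 cs0; apply: mulr_gt0.
    by apply: powR_gt0; rewrite divr_gt0.
  by apply: mulr_gt0 => //; exact: powR_gt0.
have {fM} : ((X * (pi^-1 * (2 * eta) ^+ 2))%:E <= M%:E)%E.
  apply: le_trans fM; apply: le_trans; last first.
    by apply: ereal_sup_ubound; exists a.
  apply: area_integral_ge => //.
  - by move=> w /Q[/dr1].
  - by move=> w _; rewrite lee_fin !mulr_ge0 ?powR_ge0.
  move=> w /Q[wa gw]; rewrite lee_fin.
  apply: ler_pM.
  - by apply: mulr_ge0; [exact: powR_ge0|apply: mulr_ge0; [exact: ltW|exact: powR_ge0]].
  - exact: ltW.
  - apply: ler_pM; [exact: powR_ge0|
      by apply: mulr_ge0; [exact: ltW|exact: powR_ge0]| |].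
      apply: ge0_ler_powR; [exact: ltW| | |exact: gw].
        by rewrite nnegrE; exact: (divr_ge0 (ltW gz0) (ler0n _ 2)).
      by rewrite nnegrE cabs_ge0.
    by apply: cqP => //; exact: ltW.
  have mw : 3 / 4 <= 1 - cabs (moebius a w) ^+ 2.
    apply: moebius_weight => //; move: wa; rewrite /r -/d; clear -d0; lra.
  apply: ge0_ler_powR; [exact: ltW|by rewrite nnegrE; exact: (divr_ge0 (ler0n _ 3) (ler0n _ 4))| |exact: mw].
  by rewrite nnegrE; apply: le_trans mw; exact: (divr_ge0 (ler0n _ 3) (ler0n _ 4)).
rewrite lee_fin => XM.
have M0 : 0 <= M.
  apply: le_trans XM; apply: mulr_ge0; first exact: ltW.
  by apply: mulr_ge0; [rewrite invr_ge0; exact/ltW/pi_gt0|exact: sqr_ge0].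
have alE : p * alpha / p = alpha by rewrite mulrAC mulfV ?mul1r// gt_eqF.
have rhoE : rho = 2 * 256 * K * eta.
  by rewrite /eta; field; rewrite gt_eqF.
have qE : q + 2 = p * alpha by rewrite /q subrK.
have XM' : (g z / 2) `^ p * (cq * cs * d `^ q) * (pi^-1 * (2 * eta) ^+ 2) <= M.
  by apply: le_trans XM; rewrite /X le_eqVlt; apply/orP; left; apply/eqP; ring.
have c256 : 0 < 256 :> R by rewrite ltr0n.
have := @powR_comparison p q (p * alpha) 256 K r rho eta (g z) d (g a) M
  (cq * cs) pi p0 (mulr_gt0 p0 al0) (mulr_gt0 cq0 cs0) (pi_gt0 R) c256 K0 d0 rho0 M0
  ga gz0 qE rhoE erefl gz XM'.
by rewrite alE.
Qed.

End GrowthOfDerivative.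

(** * Modulus of continuity up to the circle *)

Section UniformModulus.
Variable R : realType.
Local Notation C := (Cplx R).
Local Notation "x %:C" := (real_complex R x).
Implicit Types (f : C -> C) (z w : C).

Lemma powR_subadditive (b x y : R) : 0 < b -> b <= 1 -> 0 <= x -> 0 <= y ->
  (x + y) `^ b <= x `^ b + y `^ b.
Proof.
move=> b0 b1 x0 y0; have := addr_ge0 x0 y0; rewrite le_eqVlt => /predU1P[s0|s0].
  by rewrite -s0 powR0 ?gt_eqF// addr_ge0 ?powR_ge0.
have part (u : R) : 0 <= u -> u <= x + y -> (x + y) `^ b * (u / (x + y)) <= u `^ b.
  move=> u0 us; rewrite -[leRHS](_ : ((x + y) * (u / (x + y))) `^ b = _); last first.
    by congr (_ `^ _); field; rewrite gt_eqF.
  have q0 : 0 <= u / (x + y) by rewrite divr_ge0// ltW.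
  rewrite powRM ?(ltW s0)//; apply: ler_wpM2l; first exact: powR_ge0.
  move: q0; rewrite le_eqVlt => /predU1P[<-|q0]; first exact: powR_ge0.
  by apply: ger1_powR => //; rewrite q0 ler_pdivrMr// mul1r.
have -> : (x + y) `^ b = (x + y) `^ b * (x / (x + y)) + (x + y) `^ b * (y / (x + y)).
  by field; rewrite gt_eqF.
by apply: lerD; apply: part; rewrite // ?lerDl ?lerDr.
Qed.

Definition deriv_growth (al B : R) f := analytic f /\
  forall z, disk z -> cabs (derive1 f z) <= B * (1 - cabs z) `^ (- al).

(** The bound on the derivative is integrated along radii; it is integrable
    up to the circle as al < 1. *)
Lemma growth_radial (al B : R) f z (rho : R) : 0 < al -> al < 1 -> 0 <= B ->
  deriv_growth al B f -> disk z -> 0 <= rho -> rho <= 1 ->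
  cabs (f z - f (rho%:C * z)) <= B / (1 - al) * (1 - rho) `^ (1 - al).
Proof.
move=> al0 al1 B0 [fA fB] z1 rho0 rho1; set b := 1 - al.
have b0 : 0 < b by rewrite subr_gt0.
have bN : b != 0 by rewrite gt_eqF.
set m := cabs z; have m0 : 0 <= m by exact: cabs_ge0.
have m1 : m < 1 by [].
have tm (t : R) : rho <= t -> t <= 1 -> 0 < 1 - t * m by move=> h1 h2; nra.
have tz (t : R) : rho <= t -> cabs (0 + t%:C * z) = t * m.
  by move=> h; rewrite add0r cabsM cabs_real ger0_norm// (le_trans rho0).
(* a primitive of the bound B m (1 - t m)^-al on the radius; since m < 1 it is smooth
   up to t = 1 *)
pose psi (t : R) : R := - (B / b) * (1 - t * m) `^ b.
pose dpsi (t : R) : R := B * (m * (1 - t * m) `^ (- al)).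
have psid (t : R) : rho <= t -> t <= 1 -> is_derive t 1 psi (dpsi t).
  move=> h1 h2; have ht := tm t h1 h2.
  have d1 : is_derive t 1 (fun u : R => 1 - u * m) (- m).
    apply: is_derive_real => e e0; exists 1 => // u _.
    rewrite (_ : 1 - u * m - (1 - t * m) - - m * (u - t) = 0); last by ring.
    by rewrite normr0 mulr_ge0// ltW.
  have d2 : is_derive (1 - t * m) 1 (fun v : R => v `^ b) (b * (1 - t * m) `^ (b - 1)).
    exact: is_derive1_powR.
  have d3 := @is_derive1_comp R (fun v : R => v `^ b) (fun u : R => 1 - u * m) t _ _ d2 d1.
  have := is_deriveZ (- (B / b)) d3.
  congr (is_derive _ _ _ _); rewrite /dpsi /GRing.scale/=.
  rewrite (_ : b - 1 = - al); last by rewrite /b; ring.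
  by field.
have := @cmean_value R f (fun t => derive1 f (0 + t%:C * z)) 0 z psi dpsi rho 1 rho1.
rewrite !add0r rmorph1 mul1r => main.
apply: le_trans (main _ _ _ _) _.
- move=> t /andP[h1 h2]; apply: derivable_cdiff; apply: fA.
  by rewrite /disk/= tz//; have := tm t h1 h2; lra.
- by move=> t /andP[h1 h2]; apply: psid; exact: ltW.
- apply: derivable_within_continuous => t; rewrite in_itv/= => /andP[h1 h2].
  by have [] := psid t h1 h2.
- move=> t /andP[/ltW h1 /ltW h2]; have ht := tm t h1 h2.
  have td : disk (0 + t%:C * z) by rewrite /disk/= tz//; lra.
  rewrite cabsM -/m; have := fB _ td; rewrite tz// => h.
  apply: le_trans (ler_wpM2r m0 h) _.
  by rewrite /dpsi le_eqVlt; apply/orP; left; apply/eqP; ring.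
have -> : psi 1 - psi rho = B / b * ((1 - rho * m) `^ b - (1 - m) `^ b).
  by rewrite /psi mul1r; ring.
have Bb : 0 <= B / b by rewrite divr_ge0// ltW.
apply: ler_wpM2l => //; rewrite lerBlDr.
have mr : 0 <= m * (1 - rho) by rewrite mulr_ge0// subr_ge0.
have -> : 1 - rho * m = m * (1 - rho) + (1 - m) by ring.
apply: le_trans (powR_subadditive _ _ mr _) _ => //.
- by rewrite /b lerBlDr lerDl ltW.
- by rewrite subr_ge0 ltW.
rewrite lerD2r; apply: ge0_ler_powR; rewrite ?nnegrE ?subr_ge0//; first exact: ltW.
by rewrite ler_piMl ?subr_ge0// ltW.
Qed.

Lemma growth_bounded (al B : R) f z : 0 < al -> al < 1 -> 0 <= B ->
  deriv_growth al B f -> disk z -> cabs (f z) <= cabs (f 0) + B / (1 - al).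
Proof.
move=> al0 al1 B0 fB z1.
have := growth_radial al0 al1 B0 fB z1 (lexx 0) ler01.
rewrite rmorph0 mul0r subr0 powR1 mulr1.
by have := cabsD (f z - f 0) (f 0); rewrite subrK; lra.
Qed.

(** The radial estimate moves both points into a smaller disc, where the
    derivative is bounded. *)
Lemma growth_equicontinuous (al B e : R) : 0 < al -> al < 1 -> 0 <= B -> 0 < e ->
  exists2 d : R, 0 < d & forall f, deriv_growth al B f ->
    forall z w, disk z -> disk w -> cabs (z - w) < d -> cabs (f z - f w) < e.
Proof.
move=> al0 al1 B0 e0; set b := 1 - al.
have b0 : 0 < b by rewrite subr_gt0.
have bN : b != 0 by rewrite gt_eqF.
have B1 : 0 < B + 1 by lra.
pose y := e / 4 * (b / (B + 1)).
have y0 : 0 < y by rewrite mulr_gt0// divr_gt0.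
pose x := Num.min 1 (y `^ b^-1).
have x0 : 0 < x by rewrite lt_min ltr01 powR_gt0.
have x1 : x <= 1 by rewrite ge_min lexx.
have xy : x `^ b <= y.
  have -> : y = (y `^ b^-1) `^ b by rewrite -powRrM mulVf// powRr1// ltW.
  apply: ge0_ler_powR; rewrite ?nnegrE ?powR_ge0 ?(ltW b0) ?(ltW x0)//.
  by rewrite ge_min lexx orbT.
pose rho := 1 - x; have rho0 : 0 <= rho by rewrite subr_ge0.
have rho1 : rho <= 1 by rewrite lerBlDr lerDl ltW.
pose L := B * x `^ (- al); have L0 : 0 <= L by rewrite mulr_ge0// powR_ge0.
have L1 : 0 < 4 * (L + 1) by lra.
exists (e / (4 * (L + 1))); first exact: divr_gt0.
move=> f fB z w z1 w1; rewrite ltr_pdivlMr// => zw.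
have rad u : disk u -> cabs (f u - f (rho%:C * u)) <= e / 4.
  move=> u1; apply: le_trans (growth_radial al0 al1 B0 fB u1 rho0 rho1) _.
  have -> : 1 - rho = x by rewrite /rho; ring.
  have Bb : 0 <= B / b by rewrite divr_ge0// ltW.
  apply: le_trans (ler_wpM2l Bb xy) _.
  have -> : B / b * y = e / 4 * (B / (B + 1)) by rewrite /y; field; rewrite bN gt_eqF.
  apply: ler_piMr; first by rewrite divr_ge0// ltW.
  by rewrite ler_pdivrMr// mul1r lerDl.
have mid : cabs (f (rho%:C * w) - f (rho%:C * z)) <= L * cabs (rho%:C * w - rho%:C * z).
  have seg (t : R) : 0 <= t <= 1 ->
      cabs (rho%:C * z + t%:C * (rho%:C * w - rho%:C * z)) <= rho.
    move=> /andP[t0 t1].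
    have -> : rho%:C * z + t%:C * (rho%:C * w - rho%:C * z) =
        rho%:C * ((1 - t)%:C * z + t%:C * w) by rewrite rmorphB/= rmorph1; ring.
    rewrite cabsM cabs_real ger0_norm//; apply: ler_piMr => //.
    apply: le_trans (cabsD _ _) _; rewrite !cabsM !cabs_real !ger0_norm ?subr_ge0//.
    move: z1 w1; rewrite /disk/= => z1 w1; have := cabs_ge0 z; have := cabs_ge0 w.
    by clear -z1 w1 t0 t1; nra.
  have dsk u : cabs u <= rho -> disk u.
    by rewrite /disk/= => /le_lt_trans; apply; rewrite /rho; lra.
  apply: (@cmean_value_Lip _ f
    (fun t => derive1 f (rho%:C * z + t%:C * (rho%:C * w - rho%:C * z)))).
    by move=> t /seg /dsk; case: fB => fA _ /fA /derivable_cdiff.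
  move=> t /seg tr; case: fB => _ /(_ _ (dsk _ tr)) /le_trans; apply.
  apply: ler_wpM2l => //; rewrite !powRN lef_pV2 ?posrE ?powR_gt0//; last first.
    by rewrite subr_gt0; apply: le_lt_trans tr _; rewrite /rho; lra.
  apply: ge0_ler_powR; rewrite ?nnegrE ?(ltW al0) ?(ltW x0)//.
    by rewrite subr_ge0; apply: le_trans tr _.
  rewrite [leLHS](_ : x = 1 - rho); last by rewrite /rho; ring.
  by rewrite lerD2l lerN2.
have mid2 : cabs (f (rho%:C * w) - f (rho%:C * z)) <= e / 4.
  apply: le_trans mid _; rewrite -mulrBr cabsM cabs_real ger0_norm// cabsC.
  have h : rho * cabs (z - w) <= cabs (z - w) by rewrite ler_piMl// cabs_ge0.
  apply: le_trans (ler_wpM2l L0 h) _.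
  by have := cabs_ge0 (z - w); clear -zw; lra.
have := rad z z1; have := rad w w1.
have := cabs_tri (f (rho%:C * z)) (f z) (f w).
have := cabs_tri (f (rho%:C * w)) (f (rho%:C * z)) (f w).
rewrite (cabsC (f (rho%:C * z)) (f (rho%:C * w))) (cabsC (f (rho%:C * w)) (f w)).
by clear -mid2 e0; lra.
Qed.

End UniformModulus.

(** * Uniform convergence of subsequences *)

Section Montel.
Variable R : realType.
Local Notation C := (Cplx R).
Implicit Types (f g : C -> C) (z w : C).

Lemma ultra_lim_real (U : set_system nat) (v : nat -> R) (M : R) : UltraFilter U ->
  (forall n, `|v n| <= M) ->
  exists l, forall e, 0 < e -> U [set n | `|v n - l| < e].
Proof.
move=> UU vM; have UP : ProperFilter U by exact: ultra_proper.
have vI : (v @ U) `[- M, M]%classic.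
  change (U (v @^-1` `[- M, M]%classic)); apply: filterE => n.
  by rewrite /= in_itv/= -ler_norml; exact: vM.
have [l [_ vl]] := @segment_compact R (- M) M (v @ U) _ vI.
exists l => e e0.
have [//|Uc] := in_ultra_setVsetC [set n | `|v n - l| < e] UU.
have vUc : (v @ U) [set y | ~ (`|y - l| < e)] by [].
have le : nbhs l [set y | `|y - l| < e].
  by apply/nbhs_ballP; exists e => // y; rewrite /ball/= distrC.
by have [y [/= yl yl']] := vl _ _ vUc le.
Qed.

Lemma ultra_lim (U : set_system nat) (u : nat -> C) (M : R) : UltraFilter U ->
  (forall n, cabs (u n) <= M) ->
  exists l : C, forall e, 0 < e -> U [set n | cabs (u n - l) < e].
Proof.
move=> UU uM; have UP : ProperFilter U by exact: ultra_proper.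
have [x xP] := @ultra_lim_real U (fun n => complex.Re (u n)) M UU
  (fun n => le_trans (Re_le_cabs _) (uM n)).
have [y yP] := @ultra_lim_real U (fun n => complex.Im (u n)) M UU
  (fun n => le_trans (Im_le_cabs _) (uM n)).
exists (Complex x y) => e e0; have e20 : 0 < e / 2 by rewrite divr_gt0.
apply: filterS (filterI (xP _ e20) (yP _ e20)) => n [].
rewrite /mkset => h1 h2; apply: le_lt_trans (cabs_le_ReIm _) _.
rewrite [ltRHS]splitr; apply: ltrD.
  by move: h1; case: (u n).
by move: h2; case: (u n).
Qed.

(** Arzela and Ascoli without a diagonal argument: g is the pointwise limit along
    an ultrafilter finer than that of the neighbourhoods of infinity. If
    the convergence along it were not uniform, the points where it fails would
    have a limit along it, near which equicontinuity gives a contradiction. *)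
Lemma uniform_subsequence (f_ : nat -> C -> C) (D : set C) (r M : R) :
  0 <= r -> (forall z, D z -> cabs z <= r) ->
  (forall n z, D z -> cabs (f_ n z) <= M) ->
  (forall e, 0 < e -> exists2 d : R, 0 < d & forall n z w, D z -> D w ->
    cabs (z - w) < d -> cabs (f_ n z - f_ n w) < e) ->
  exists (k : nat -> nat) (g : C -> C),
    [/\ forall m n, (m < n)%N -> (k m < k n)%N,
        forall z, D z -> cabs (g z) <= M,
        forall e, 0 < e -> exists2 d : R, 0 < d & forall z w, D z -> D w ->
          cabs (z - w) < d -> cabs (g z - g w) < e
      & forall n z, D z -> cabs (f_ (k n) z - g z) < n.+1%:R^-1].
Proof.
move=> r0 Dr fM equi.
have [U [UU ooU]] := ultraFilterLemma (_ : ProperFilter \oo).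
have UP : ProperFilter U by exact: ultra_proper.
have glim z : exists l : C, D z -> forall e, 0 < e -> U [set n | cabs (f_ n z - l) < e].
  have [Dz|nDz] := pselect (D z); last by exists 0.
  by have [l lP] := @ultra_lim U (fun n => f_ n z) M UU (fun n => fM n z Dz); exists l.
have [g gP] := choice glim.
have gM z : D z -> cabs (g z) <= M.
  move=> Dz; apply/ler_addgt0Pr => e e0.
  have [n /= ne] := filter_ex (gP z Dz e e0).
  by have := cabsB (f_ n z) (f_ n z - g z); rewrite subKr; have := fM n z Dz; lra.
have gequi e : 0 < e -> exists2 d : R, 0 < d & forall z w, D z -> D w ->
    cabs (z - w) < d -> cabs (g z - g w) < e.
  move=> e0; have e40 : 0 < e / 4 by rewrite divr_gt0.
  have [d d0 dP] := equi _ e40; exists d => // z w Dz Dw zw.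
  have [n /= [n1 n2]] := filter_ex (filterI (gP z Dz _ e40) (gP w Dw _ e40)).
  have n3 := dP n z w Dz Dw zw.
  have := cabs_tri (f_ n z) (g z) (g w); have := cabs_tri (f_ n w) (f_ n z) (g w).
  by rewrite (cabsC (g z) (f_ n z)); lra.
have unif e : 0 < e -> U [set n | forall z, D z -> cabs (f_ n z - g z) < e].
  move=> e0; have e40 : 0 < e / 4 by rewrite divr_gt0.
  have [//|Uc] := in_ultra_setVsetC
    [set n | forall z, D z -> cabs (f_ n z - g z) < e] UU.
  exfalso; set V := ~` _ in Uc.
  have bad n : exists z, cabs z <= r /\ (V n -> D z /\ e <= cabs (f_ n z - g z)).
    have [/existsNP[z /not_implyP[Dz /negP]]|nV] := pselect (V n).
      by rewrite -leNgt => ze; exists z; split => //; exact: Dr.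
    by exists 0; rewrite cabs0.
  have [zs zsP] := choice bad.
  have [zl zlP] := @ultra_lim U zs r UU (fun n => (zsP n).1).
  have [d1 d10 d1P] := equi _ e40; have [d2 d20 d2P] := gequi _ e40.
  pose d := Num.min d1 d2; have d0 : 0 < d by rewrite lt_min d10.
  have W := zlP _ (divr_gt0 d0 (ltr0n _ 2)).
  have [m /= [mV mW]] := filter_ex (filterI Uc W).
  have [_ /(_ mV)[Dw _]] := zsP m; set w := zs m in Dw mW.
  have [n /= [[nV nW] nw]] := filter_ex (filterI (filterI Uc W) (gP w Dw _ e40)).
  have [_ /(_ nV)[Dz ze]] := zsP n.
  have zw : cabs (zs n - w) < d.
    by have := cabs_tri zl (zs n) w; rewrite (cabsC zl w); lra.
  have h1 : cabs (f_ n (zs n) - f_ n w) < e / 4.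
    by apply: d1P => //; apply: lt_le_trans zw _; rewrite ge_min lexx.
  have h2 : cabs (g (zs n) - g w) < e / 4.
    by apply: d2P => //; apply: lt_le_trans zw _; rewrite ge_min lexx orbT.
  have := cabs_tri (f_ n w) (f_ n (zs n)) (g (zs n)).
  have := cabs_tri (g w) (f_ n w) (g (zs n)).
  by rewrite (cabsC (g w) (g (zs n))); lra.
have next (Nj : nat * nat) : exists n, (Nj.1 < n)%N /\
    forall z, D z -> cabs (f_ n z - g z) < Nj.2.+1%:R^-1.
  have jp : 0 < Nj.2.+1%:R^-1 :> R by rewrite invr_gt0.
  have big : U [set n | (Nj.1 < n)%N] by apply: ooU; exists Nj.1.+1.
  by have [n /= [h1 h2]] := filter_ex (filterI big (unif _ jp)); exists n.
have [pick pickP] := choice next.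
pose fix k n := if n is n'.+1 then pick (k n', n'.+1) else pick (0, 0)%N.
exists k, g; split => //.
  have inc n : (k n < k n.+1)%N by have [] := pickP (k n, n.+1).
  move=> m; elim=> // n ih; rewrite ltnS leq_eqVlt => /predU1P[->|/ih/ltn_trans].
    exact: inc.
  by apply; exact: inc.
by case=> [|n] z Dz; [have [_] := pickP (0, 0)%N|have [_] := pickP (k n, n.+1)]; apply.
Qed.

End Montel.

(** * Carleson boxes are Borel sets *)

Section CarlesonBoxes.
Variable R : realType.
Local Notation C := (Cplx R).
Implicit Types (I : circle_arc R) (z w : C).

Lemma arc_len_gt0 I : 0 < arc_len I.
Proof. by rewrite divr_gt0 ?subr_gt0 ?arc_lt// mulr_gt0// pi_gt0. Qed.

Lemma arc_len_le1 I : arc_len I <= 1.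
Proof.
rewrite /arc_len ler_pdivrMr; last by rewrite mulr_gt0// pi_gt0.
by rewrite mul1r lerBlDl arc_le.
Qed.

Definition polar (u : R * R) : C := Complex (u.1 * cos u.2) (u.1 * sin u.2).

Lemma continuous_Complex (X : topologicalType) (u v : X -> R) :
  continuous u -> continuous v -> continuous (fun x => Complex (u x) (v x) : C).
Proof.
move=> uc vc x A /nbhs_cabs[e e0 eA].
have e20 : 0 < e / 2 by rewrite divr_gt0.
have /cvgrPdist_lt/(_ _ e20) hu := uc x.
have /cvgrPdist_lt/(_ _ e20) hv := vc x.
apply: filterS (filterI hu hv) => y [h1 h2]; apply: eA.
apply: le_lt_trans (cabs_le_ReIm _) _; rewrite [ltRHS]splitr /=.
by rewrite ltrD// distrC.
Qed.

Lemma continuous_polar : continuous polar.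
Proof.
apply: continuous_Complex => u.
  apply: cvgM; first exact: cvg_fst.
  by apply: (continuous_comp cvg_snd); exact: continuous_cos.
apply: cvgM; first exact: cvg_fst.
by apply: (continuous_comp cvg_snd); exact: continuous_sin.
Qed.

Lemma measurable_polar_rect (a b c d : R) :
  measurable (polar @` (`[a, b] `*` `[c, d]) : set (BorelC R)).
Proof.
have K : compact (polar @` (`[a, b] `*` `[c, d])).
  apply: continuous_compact; first exact/continuous_subspaceT/continuous_polar.
  by apply: compact_setX; exact: segment_compact.
have Kc := compact_closed (@norm_hausdorff _ C) K.
rewrite -[X in measurable X]setCK; apply: measurableC.
by apply: measurable_openC; exact: closed_openC.
Qed.

Lemma cabs_polar u : 0 <= u.1 -> cabs (polar u) = u.1.
Proof.
move=> u0; rewrite /polar /= !exprMn -mulrDr cos2Dsin2 mulr1 sqrtr_sqr.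
by rewrite ger0_norm.
Qed.

(** Arcs may be open or half-open at their endpoints, so the box is a countable union of
    compact polar rectangles and not closed in general. *)
Lemma measurable_carleson_box I :
  measurable (carleson_box I : set (BorelC R)).
Proof.
pose h n : R := n.+1%:R^-1.
pose lo n := arc_lo I + (if arc_lo_in I then 0 else h n).
pose hi n := arc_hi I - (if arc_hi_in I then 0 else h n).
rewrite (_ : carleson_box I = \bigcup_n
    (polar @` (`[1 - arc_len I + h n, 1 - h n] `*` `[lo n, hi n]))).
  by apply: bigcupT_measurable => n; exact: measurable_polar_rect.
have h0 n : 0 < h n by rewrite invr_gt0.
have L1 := arc_len_le1 I.
apply/seteqP; split=> z.
  move=> [/andP[z1 z2] [t /= tI zt]].
  have zp : 0 < cabs z by apply: le_lt_trans z1; rewrite subr_ge0.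
  have zE : z = polar (cabs z, t).
    have : z = Complex (cabs z) 0 * (z / Complex (cabs z) 0).
      rewrite mulrCA mulfV ?mulr1// eq_complex /= eqxx andbT gt_eqF//.
    rewrite -zt /polar /= => {1}->.
    by apply/eqP; rewrite eq_complex /= !mul0r subr0 addr0 !eqxx.
  have small (x : R) : 0 < x -> exists N, forall n, (N <= n)%N -> h n <= x.
    move=> x0; have [N _ NP] := near_infty_natSinv_lt (PosNum x0).
    by exists N => n /NP /ltW.
  have gap (b : bool) (x y : R) : x < y ?<= if b -> exists N, forall n, (N <= n)%N ->
      x + (if b then 0 else h n) <= y.
    case: b => /= xy; first by exists 0%N => n _; rewrite addr0.
    have yx : 0 < y - x by rewrite subr_gt0.
    by have [N NP] := small _ yx; exists N => n /NP; rewrite lerBrDl.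
  have w1 : 0 < cabs z - (1 - arc_len I) by rewrite subr_gt0.
  have w2 : 0 < 1 - cabs z by rewrite subr_gt0.
  have [N1 N1P] := small _ w1; have [N2 N2P] := small _ w2.
  move: tI; rewrite in_itv/= negbK => /andP[/gap[N3 N3P] /gap[N4 N4P]].
  pose n := (N1 + N2 + N3 + N4)%N; exists n => //.
  exists (cabs z, t) => //=; rewrite !in_itv/=.
  have n1 : (N1 <= n)%N by rewrite /n -!addnA leq_addr.
  have n2 : (N2 <= n)%N by rewrite /n (addnC N1) -!addnA leq_addr.
  have n3 : (N3 <= n)%N by rewrite /n addnAC leq_addl.
  have n4 : (N4 <= n)%N by rewrite /n leq_addl.
  move: (N1P n n1) (N2P n n2) (N3P n n3) (N4P n n4); rewrite /lo /hi => k1 k2 k3 k4.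
  split; apply/andP; split => //; rewrite ?lerBrDr//.
    by move: k1; rewrite lerBrDl.
  by move: k2; rewrite lerBrDl addrC.
move=> [n _ [[r t] [/= ]]]; rewrite !in_itv/= => /andP[r1 r2] /andP[t1 t2] <-.
have r0 : 0 < r by apply: lt_le_trans r1; rewrite ltr_wpDl// subr_ge0.
split.
  rewrite cabs_polar ?ltW//=; apply/andP; split.
    by apply: lt_le_trans r1; rewrite ltrDl.
  by apply: le_lt_trans r2 _; rewrite ltrBlDr ltrDl.
exists t.
  rewrite /= in_itv/= negbK; move: t1 t2; rewrite /lo /hi.
  case: (arc_lo_in I); case: (arc_hi_in I); rewrite /= ?addr0 ?subr0 => t1 t2;
    apply/andP; split => //.
  - by apply: le_lt_trans t2 _; rewrite ltrBlDr ltrDl.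
  - by apply: lt_le_trans t1; rewrite ltrDl.
  - by apply: lt_le_trans t1; rewrite ltrDl.
  - by apply: le_lt_trans t2 _; rewrite ltrBlDr ltrDl.
rewrite cabs_polar ?ltW//=.
have rn : Complex r 0 != 0 :> C by rewrite eq_complex /= eqxx andbT gt_eqF.
have -> : polar (r, t) = Complex r 0 * Complex (cos t) (sin t).
  by rewrite /polar /=; apply/eqP; rewrite eq_complex /= !mul0r subr0 addr0 !eqxx.
by rewrite mulrAC mulfV// mul1r.
Qed.

End CarlesonBoxes.

(** * Tent norms, and the equivalences *)

Section TentNorm.
Variable R : realType.
Local Notation C := (Cplx R).
Variable mu : {measure set (BorelC R) -> \bar R}.
Implicit Types (f g h : C -> C) (I : circle_arc R) (A s p c : R).

(** Monotonicity for functions that may fail to be measurable, from the definition of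
    the integral as a supremum. *)
Lemma ge0_le_integral_pointwise d (T : measurableType d)
    (m : {measure set T -> \bar R}) (D : set T) (f g : T -> \bar R) :
  (forall x, D x -> 0%E <= f x)%E -> (forall x, D x -> f x <= g x)%E ->
  (\int[m]_(x in D) f x <= \int[m]_(x in D) g x)%E.
Proof.
move=> f0 fg; have g0 x : D x -> (0%E <= g x)%E.
  by move=> Dx; exact: le_trans (f0 x Dx) (fg x Dx).
rewrite !ge0_set_function_integralE// ?measure0//; apply: ereal_sup_le.
move=> _ [u /= uf <-]; exists u => //= x; apply: le_trans (uf x) _.
by rewrite /patch; case: ifPn => // /set_mem; exact: fg.
Qed.

Lemma full_arc_lt : (0 : R) < 2 * pi.
Proof. by rewrite mulr_gt0// pi_gt0. Qed.

Lemma full_arc_le : 2 * pi <= 0 + 2 * pi :> R.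
Proof. by rewrite add0r. Qed.

(** The whole circle; its box shows that suprema over arcs are nonnegative. *)
Definition full_arc : circle_arc R := CircleArc true true full_arc_lt full_arc_le.

Lemma T_norm_pow_ge0 p s f : (0 <= T_norm_pow mu p s f)%E.
Proof.
apply: (@le_trans _ _ ((arc_len full_arc `^ (- s))%:E *
    \int[mu]_(z in carleson_box full_arc) ((cabs (f z)) `^ p)%:E)%E).
  apply: mule_ge0; first by rewrite lee_fin powR_ge0.
  by apply: integral_ge0 => z _; rewrite lee_fin powR_ge0.
by apply: ereal_sup_ubound; exists full_arc.
Qed.

(** The constant 1 turns the tent norm into the Carleson constant. *)
Lemma carleson_measureE p s :
  carleson_measure mu s <-> (T_norm_pow mu p s (fun=> 1%R : C) < +oo)%E.
Proof.
rewrite /carleson_measure /T_norm_pow.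
suff -> : [set (mu (carleson_box I) * ((arc_len I `^ s)^-1)%:E)%E | I in [set: circle_arc R]] =
  [set (((arc_len I) `^ (- s))%:E * \int[mu]_(z in carleson_box I)
     ((cabs (1%R : C)) `^ p)%:E)%E | I in [set: circle_arc R]] by [].
congr image; apply/funext => I.
rewrite cabs1 powR1 (integral_cst _ (measurable_carleson_box I)) mul1e.
by rewrite powRN muleC.
Qed.

Lemma carleson_bound s : carleson_measure mu s ->
  exists2 A : R, 0 <= A & forall I,
    (mu (carleson_box I) <= (A * arc_len I `^ s)%:E)%E.
Proof.
rewrite /carleson_measure; set S := ereal_sup _ => Soo.
have bnd I : (mu (carleson_box I) * ((arc_len I `^ s)^-1)%:E <= S)%E.
  by apply: ereal_sup_ubound; exists I.
have S0 : (0 <= S)%E.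
  apply: le_trans (bnd full_arc); apply: mule_ge0 => //.
  by rewrite lee_fin invr_ge0 powR_ge0.
have SE : S = (fine S)%:E by rewrite fineK// ge0_fin_numE.
exists (fine S); first by rewrite fine_ge0.
move=> I; have := bnd I; rewrite SE.
have l0 : 0 < arc_len I `^ s by rewrite powR_gt0// arc_len_gt0.
have lE : (0 <= (arc_len I `^ s)%:E)%E by rewrite lee_fin ltW.
move=> /(lee_wpmul2r lE); rewrite -muleA -!EFinM mulVf ?gt_eqF// mule1.
by [].
Qed.

Lemma T_norm_pow_le A s p c h : 0 < p -> 0 <= A ->
  (forall I, (mu (carleson_box I) <= (A * arc_len I `^ s)%:E)%E) -> 0 <= c ->
  (forall z, disk z -> cabs (h z) <= c) ->
  (T_norm_pow mu p s h <= (c `^ p * A)%:E)%E.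
Proof.
move=> p0 A0 muA c0 hc; apply: ge_ereal_sup => _ [I _ <-].
have l0 : 0 < arc_len I `^ s by rewrite powR_gt0// arc_len_gt0.
have le1 : (\int[mu]_(z in carleson_box I) ((cabs (h z)) `^ p)%:E <=
    (c `^ p)%:E * (A * arc_len I `^ s)%:E)%E.
  apply: (@le_trans _ _ (\int[mu]_(z in carleson_box I) ((c `^ p)%:E))%E).
    apply: ge0_le_integral_pointwise => z; first by rewrite lee_fin powR_ge0.
    move=> [/andP[_ z1] _]; rewrite lee_fin.
    apply: ge0_ler_powR; [exact: ltW|by rewrite nnegrE cabs_ge0|by []|exact: hc].
  rewrite (integral_cst _ (measurable_carleson_box I)).
  by apply: lee_wpmul2l; rewrite ?lee_fin ?powR_ge0.
have l1 : (0 <= (arc_len I `^ (- s))%:E)%E by rewrite lee_fin powR_ge0.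
apply: le_trans (lee_wpmul2l l1 le1) _.
rewrite -!EFinM lee_fin powRN le_eqVlt; apply/orP; left; apply/eqP.
by field; rewrite gt_eqF.
Qed.

Lemma T_norm_le A s p c h : 0 < p -> 0 <= A ->
  (forall I, (mu (carleson_box I) <= (A * arc_len I `^ s)%:E)%E) -> 0 <= c ->
  (forall z, disk z -> cabs (h z) <= c) ->
  (T_norm mu p s h <= (c * A `^ p^-1)%:E)%E.
Proof.
move=> p0 A0 muA c0 hc; rewrite /T_norm.
have -> : (c * A `^ p^-1)%:E = poweR (c `^ p * A)%:E p^-1.
  rewrite poweR_EFin powRM// ?powR_ge0// -powRrM mulfV ?gt_eqF// powRr1//.
apply: gt0_ler_poweR; first by rewrite invr_ge0 ltW.
- by rewrite in_itv/= T_norm_pow_ge0 leey.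
- by rewrite in_itv/= leey andbT lee_fin mulr_ge0// powR_ge0.
- exact: T_norm_pow_le.
Qed.

Lemma disk_continuous_measurable f :
  (forall z, disk z -> {for z, continuous f}) ->
  measurable_fun (@disk R : set (BorelC R)) (f : BorelC R -> BorelC R).
Proof.
move=> fc; apply: (@measurability _ _ (BorelC R) (BorelC R) _ _ (@open C)) => //.
move=> _ [B oB <-]; apply: measurable_openC.
rewrite openE => z [z1 fB]; apply/nbhs_cabs.
have /(fc z z1)/nbhs_cabs[r r0 rB] : nbhs (f z) B by exact: open_nbhs_nbhs.
have w1 : 0 < 1 - cabs z by rewrite subr_gt0.
exists (Num.min r (1 - cabs z)); first by rewrite lt_min r0.
move=> w; rewrite lt_min => /andP[wr wz]; split; last exact: rB.
by rewrite /disk/=; have := cabsD (w - z) z; rewrite subrK; lra.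
Qed.

End TentNorm.

Section FSpaceFacts.
Variable R : realType.
Local Notation C := (Cplx R).
Implicit Types (f : C -> C) (p q s M : R).

Lemma F_seminorm_pow_ge0 p q s f : (0 <= F_seminorm_pow p q s f)%E.
Proof.
apply: (@le_trans _ _ (\int[@area R]_(z in @disk R)
      ((cabs (derive1 f z)) `^ p * (1 - cabs z ^+ 2) `^ q
         * (1 - cabs (moebius 0 z) ^+ 2) `^ s)%:E)%E).
  apply: set_function_integral_ge0; first exact: area_set0.
  by move=> z _; rewrite lee_fin !mulr_ge0// powR_ge0.
by apply: ereal_sup_ubound; exists 0 => //; change (cabs (0 : C) < 1); rewrite cabs0.
Qed.

Lemma F_seminorm_pow_cst p q s (c : C) : 0 < p -> F_seminorm_pow p q s (fun=> c) = 0%E.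
Proof.
move=> p0; apply/eqP; rewrite eq_le F_seminorm_pow_ge0 andbT.
apply: ge_ereal_sup => _ [a _ <-].
rewrite [X in integral _ _ X](_ : _ = (fun=> 0%E)).
  by rewrite set_function_integral_zero// area_set0.
apply/funext => z; have -> : derive1 (fun _ : C => c) z = 0 by rewrite derive1_cst.
by rewrite cabs0 powR0 ?gt_eqF// !mul0r.
Qed.

Lemma F_space_cst p q s (c : C) : 0 < p -> F_space p q s (fun=> c).
Proof.
move=> p0; split; last by rewrite F_seminorm_pow_cst.
by move=> z _; exact: derivable_cst.
Qed.

(** The growth estimate in terms of the norm: N is the seminorm of f. *)
Lemma F_space_growth (alpha s p : R) : 0 < alpha -> 0 < s -> 0 < p ->
  exists2 c0 : R, 0 < c0 & forall f, F_space p (p * alpha - 2) s f ->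
    exists2 N : R, 0 <= N &
      F_norm p (p * alpha - 2) s f = (cabs (f 0) + N)%:E /\
      deriv_growth alpha (c0 * N) f.
Proof.
move=> al0 s0 p0; have [c0 c00 c0P] := F_deriv_bound al0 s0 p0.
exists c0 => // f [fA foo].
have S0 := F_seminorm_pow_ge0 p (p * alpha - 2) s f.
set S := F_seminorm_pow _ _ _ _ in foo S0.
have SE : S = (fine S)%:E by rewrite fineK// ge0_fin_numE.
exists (fine S `^ p^-1); first exact: powR_ge0.
split; first by rewrite /F_norm -/S SE poweR_EFin.
split => // z z1; apply: c0P => //.
by rewrite -/S -SE.
Qed.

End FSpaceFacts.

Section Equivalences.
Variable R : realType.
Local Notation C := (Cplx R).
Variables (alpha s p : R).
Hypotheses (halpha0 : 0 < alpha) (halpha1 : alpha < 1) (hs : 0 < s) (hp : 0 < p).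
Variable mu : {measure set (BorelC R) -> \bar R}.
Local Notation q := (p * alpha - 2).

Lemma deriv_growth_measurable (B : R) (f : C -> C) : deriv_growth alpha B f ->
  measurable_fun (@disk R : set (BorelC R)) (f : BorelC R -> BorelC R).
Proof.
move=> [fA _]; apply: disk_continuous_measurable => z /fA /derivable_cdiff.
exact: cdiff_continuous.
Qed.

Lemma bounded_carleson : identity_bounded mu p q s -> carleson_measure mu s.
Proof.
move=> [K K0 /(_ _ (F_space_cst q s 1 hp)) b].
apply/(carleson_measureE mu p).
have p1 : p^-1 != 0 by rewrite invr_eq0 gt_eqF.
apply: (@lty_poweRy _ _ p^-1) => //.
apply: le_lt_trans b _; rewrite /F_norm F_seminorm_pow_cst// poweR0r//.
by rewrite adde0 -EFinM ltry.
Qed.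

Lemma compact_carleson : identity_compact mu p q s -> carleson_measure mu s.
Proof.
move=> [FT _]; apply/(carleson_measureE mu p).
by have [] := FT _ (F_space_cst q s 1 hp).
Qed.

Lemma carleson_bounded : carleson_measure mu s -> identity_bounded mu p q s.
Proof.
move=> /carleson_bound[A A0 muA].
have [c0 c00 growth] := F_space_growth halpha0 hs hp.
pose K := (1 + c0 / (1 - alpha)) * A `^ p^-1.
have w : 0 < 1 - alpha by rewrite subr_gt0.
have c1 : 0 <= c0 / (1 - alpha) by rewrite divr_ge0// ltW.
have K0 : 0 <= K by rewrite mulr_ge0 ?powR_ge0// addr_ge0.
exists (K + 1); first by rewrite ltr_wpDl.
move=> f /growth[N N0 [-> fB]].
have f0 := cabs_ge0 (f 0).
have cN : 0 <= c0 * N by rewrite mulr_ge0// ltW.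
pose c := cabs (f 0) + c0 * N / (1 - alpha).
have cc : 0 <= c by rewrite addr_ge0// divr_ge0// ltW.
have fc z : disk z -> cabs (f z) <= c.
  exact: growth_bounded.
apply: le_trans (T_norm_le hp A0 muA cc fc) _.
rewrite -EFinM lee_fin.
have h1 : c <= (1 + c0 / (1 - alpha)) * (cabs (f 0) + N).
  have -> : c = cabs (f 0) + c0 / (1 - alpha) * N by rewrite /c; ring.
  move: (c0 / (1 - alpha)) c1 => x x0; have := mulr_ge0 x0 f0; nra.
apply: le_trans (ler_wpM2r (powR_ge0 A p^-1) h1) _.
have -> : (1 + c0 / (1 - alpha)) * (cabs (f 0) + N) * A `^ p^-1 =
  K * (cabs (f 0) + N) by rewrite /K; ring.
by apply: ler_wpM2r; [rewrite addr_ge0|rewrite lerDl].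
Qed.

Lemma carleson_compact : carleson_measure mu s -> identity_compact mu p q s.
Proof.
move=> /carleson_bound[A A0 muA].
have [c0 c00 growth] := F_space_growth halpha0 hs hp.
have w : 0 < 1 - alpha by rewrite subr_gt0.
split.
  move=> f /growth[N N0 [_ fB]]; split; first exact: deriv_growth_measurable fB.
  have cN : 0 <= c0 * N by rewrite mulr_ge0// ltW.
  pose c := cabs (f 0) + c0 * N / (1 - alpha).
  have cc : 0 <= c by rewrite addr_ge0 ?cabs_ge0// divr_ge0// ltW.
  have fc z : disk z -> cabs (f z) <= c by exact: growth_bounded.
  exact: le_lt_trans (T_norm_pow_le hp A0 muA cc fc) (ltry _).
move=> f_ fF [M fM].
have M0 : 0 <= M.
  have [N N0 [E _]] := growth _ (fF 0%N).
  by have := fM 0%N; rewrite E lee_fin; have := cabs_ge0 (f_ 0%N 0); lra.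
have B0 : 0 <= c0 * M by rewrite mulr_ge0// ltW.
have fB n : cabs (f_ n 0) <= M /\ deriv_growth alpha (c0 * M) (f_ n).
  have [N N0 [E [fA fB]]] := growth _ (fF n).
  have := fM n; rewrite E lee_fin => NM; split; first by lra.
  split => // z z1; apply: le_trans (fB z z1) _; apply: ler_wpM2r.
    exact: powR_ge0.
  by apply: ler_wpM2l; [exact: ltW|have := cabs_ge0 (f_ n 0); lra].
pose c := M + c0 * M / (1 - alpha).
have cc : 0 <= c by rewrite addr_ge0// divr_ge0// ltW.
have fc n z : disk z -> cabs (f_ n z) <= c.
  move=> z1; have [f0 fg] := fB n.
  by apply: le_trans (growth_bounded halpha0 halpha1 B0 fg z1) _; rewrite /c lerD2r.
have equi e : 0 < e -> exists2 d : R, 0 < d & forall n z w, disk z -> disk w ->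
    cabs (z - w) < d -> cabs (f_ n z - f_ n w) < e.
  move=> e0; have [d d0 dP] := growth_equicontinuous halpha0 halpha1 B0 e0.
  by exists d => // n z w'; apply: dP; have [] := fB n.
have [k [g [kinc gc gequi kg]]] := @uniform_subsequence R f_ (@disk R) 1 c ler01
  (fun z => @ltW _ _ _ _) fc equi.
exists k, g.
  split.
    apply: disk_continuous_measurable => z z1; apply/continuous_cabsP => e e0.
    have [d d0 dP] := gequi e e0; have z2 : 0 < 1 - cabs z by rewrite subr_gt0.
    exists (Num.min d (1 - cabs z)); first by rewrite lt_min d0.
    move=> u; rewrite lt_min => /andP[ud uz]; apply: dP => //.
    by rewrite /disk/=; have := cabsD (u - z) z; rewrite subrK; lra.
  exact: le_lt_trans (T_norm_pow_le hp A0 muA cc gc) (ltry _).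
split => //.
apply: (@squeeze_cvge _ _ _ _ (cst 0%E) _ (fun n => (A `^ p^-1)%:E * (harmonic n)%:E)%E).
- near=> n; rewrite poweR_ge0/=.
  rewrite muleC -EFinM; apply: T_norm_le => //.
  by move=> z z1; rewrite ltW// kg.
- exact: cvg_cst.
- have -> : (0 : \bar R) = ((A `^ p^-1)%:E * 0)%E by rewrite mule0.
  apply: cvgeZl => //; apply: cvg_EFin; first exact: nearW.
  exact: cvg_harmonic.
Unshelve. all: by end_near. Qed.

End Equivalences.

Unset Implicit Arguments.

Theorem theorem4p2 (R : realType) (alpha s p : R)
  (halpha0 : 0 < alpha) (halpha1 : alpha < 1) (hs : 0 < s) (hp : 0 < p)
  (hsp : 1 < s + p * alpha)
  (mu : {measure set (BorelC R) -> \bar R})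
  (hmu : mu (~` @disk R) = 0%E) :
  (identity_bounded mu p (p * alpha - 2) s
     <-> identity_compact mu p (p * alpha - 2) s) /\
  (identity_compact mu p (p * alpha - 2) s <-> carleson_measure mu s).
Proof.
split; split.
- by move=> /(bounded_carleson hp); exact: carleson_compact.
- by move=> /(compact_carleson hp); exact: carleson_bounded.
- exact: compact_carleson.
- exact: carleson_compact.
Qed.
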